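(* Let $\mathbf v^\bullet=(\dim V_i(m))_{1\le i\le n-1,\,m\in\mathbb Z}$ and $\mathbf w^\bullet=(\dim W_i(m))_{1\le i\le n,\,m\in\mathbb Z}$ be finitely supported graded dimension vectors, and let $\mathbf v'^\bullet,\mathbf w'^\bullet$ be the graded dimension vectors of the spaces $$V'_j(k)=V_{\frac{j-k}2}\bigl(\tfrac{j+k}2\bigr),\qquad W'_j(k)=W_{\frac{j-k+1}2}\bigl(\tfrac{j+k-1}2\bigr)\qquad(j,k\in\mathbb Z),$$ where a space with a non-integral index or with lower index out of range is $0$. Then the graded handsaw quiver variety $\mathscr Q^\bullet(\mathbf v^\bullet,\mathbf w^\bullet)$ is isomorphic to the graded quiver variety $\mathfrak M^\bullet(\mathbf v'^\bullet,\mathbf w'^\bullet)$ of type $A$.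
   Context: **Handsaw quiver varieties.** Let $V=\bigoplus_{i=1}^{n-1}V_i$, $W=\bigoplus_{i=1}^nW_i$ be finite-dimensional graded complex vector spaces with dimension vectors $\mathbf v,\mathbf w$; put $V_n=0$. Consider quadruples $(B_1,B_2,a,b)$ with $B_1\in\bigoplus_{i=1}^{n-2}\mathrm{Hom}(V_i,V_{i+1})$, $B_2\in\bigoplus_{i=1}^{n-1}\mathrm{End}(V_i)$, $a\in\bigoplus_{i=1}^{n-1}\mathrm{Hom}(W_i,V_i)$, $b\in\bigoplus_{i=1}^{n-1}\mathrm{Hom}(V_i,W_{i+1})$, and $\mu=[B_1,B_2]+ab\in\bigoplus_i\mathrm{Hom}(V_i,V_{i+1})$. $G=\prod_iGL(V_i)$ acts by conjugation. A quadruple is stable if no proper graded subspace of $V$ is stable under $B_1,B_2$ and contains $a(W)$. $\mathscr Q(\mathbf v,\mathbf w)=\{\text{stable points of }\mu^{-1}(0)\}/G$ (a smooth variety; $G$ acts freely on stable points), and $\mathscr Q(\mathbf w)=\bigsqcup_{\mathbf v}\mathscr Q(\mathbf v,\mathbf w)$. The group $\mathbb C^*\times\prod_{i=1}^nGL(W_i)$ acts by $(t,g)\cdot(B_1,B_2,a,b)=(B_1,tB_2,ag^{-1},t\,g\,b)$. **Graded handsaw quiver varieties.** Given a grading $W_i=\bigoplus_{m\in\mathbb Z}W_i(m)$, let $s$ be the semisimple element of the Lie algebra of $\mathbb C^*\times\prod GL(W_i)$ with $\mathbb C^*$-component $1$ and acting on $W_i(m)$ by $m$. Let $\mathscr Q(\mathbf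 w)^s$ be the zero locus of the vector field of $s$. The class of $(B_1,B_2,a,b)$ lies in it iff there is a (unique) semisimple $\xi\in\bigoplus_i\mathfrak{gl}(V_i)$ with $[B_1,\xi]=0$, $[B_2,\xi]=B_2$, $\xi a=as$, $b\xi=(s+1)b$. With $V_i(m)$ the $m$-eigenspace of $\xi$ this means $B_1(V_i(m))\subset V_{i+1}(m)$, $B_2(V_i(m))\subset V_i(m-1)$, $a(W_i(m))\subset V_i(m)$, $b(V_i(m))\subset W_{i+1}(m-1)$. $\mathscr Q^\bullet(\mathbf v^\bullet,\mathbf w^\bullet)$ is the union of connected components of $\mathscr Q(\mathbf w)^s$ on which the eigenspaces of $\xi$ have dimensions $\mathbf v^\bullet$. **Graded quiver varieties of type $A$.** For finite-dimensional $V'=\bigoplus_{j,k\in\mathbb Z}V'_j(k)$, $W'=\bigoplus_{j,k\in\mathbb Z}W'_j(k)$ with graded dimension vectors $\mathbf v'^\bullet,\mathbf w'^\bullet$, consider linear maps $B_1:V'_j(k)\to V'_{j+1}(k-1)$, $B_2:V'_j(k)\to V'_{j-1}(k-1)$, $a:W'_j(k)\to V'_j(k-1)$, $b:V'_j(k)\to W'_j(k-1)$ (all $j,k$) with $B_1B_2-B_2B_1+ab=0$ as maps $V'_j(k)\to V'_j(k-2)$. Such data are stable if no proper graded subspace of $V'$ is stable under $B_1,B_2$ and contains the image of $a$. $\mathfrak M^\bullet(\mathbf v'^\bullet,\mathbf w'^\bullet)$ is the quotient of the stable data by $\prod_{j,k}GL(V'_j(k))$. *)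

(* Defs.v *)
From mathcomp Require Import all_boot all_order all_algebra.
From mathcomp Require Import complex.
From mathcomp Require Import all_classical all_reals.

Set Implicit Arguments.
Unset Strict Implicit.
Unset Printing Implicit Defensive.

Import Order.TTheory GRing.Theory Num.Theory.
Local Open Scope classical_set_scope.
Local Open Scope ring_scope.

(* Varieties over an algebraically closed field [K] are treated in the classical
   way, as spaces with functions: a set of points, its Zariski open subsets and,
   for every open [U], the [K]-valued functions regular on [U].  [regular U f]
   depends only on the restriction of [f] to [U].  (Reduced) varieties embed
   fully faithfully in spaces with functions, so an isomorphism of the latter
   between varieties is an isomorphism of varieties. *)
Record fspace (K : closedFieldType) := FSpace {
  point :> Type;
  zopen : set (set point);
  regular : set point -> set (point -> K)
}.
Arguments zopen {K} _ _.
Arguments regular {K} _ _ _.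

Definition morphism (K : closedFieldType) (X Y : fspace K) (f : X -> Y) :=
  (forall V, zopen Y V -> zopen X (f @^-1` V)) /\
  (forall V h, zopen Y V -> regular Y V h -> regular X (f @^-1` V) (h \o f)).

Definition isomorphic (K : closedFieldType) (X Y : fspace K) :=
  exists (f : X -> Y) (g : Y -> X),
    [/\ cancel f g, cancel g f, morphism f & morphism g].

(* Polynomial functions on a space [T] with a family [X] of coordinate
   functions.  The family may be infinite: for the spaces below all but finitely
   many coordinates live on zero-dimensional factors. *)
Inductive polyfun (K : closedFieldType) (T : Type) (X : set (T -> K)) :
    (T -> K) -> Prop :=
| polyfun_cst c : polyfun X (fun=> c)
| polyfun_coord x : X x -> polyfun X x
| polyfun_add p q : polyfun X p -> polyfun X q -> polyfun X (fun t => p t + q t)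
| polyfun_mul p q : polyfun X p -> polyfun X q -> polyfun X (fun t => p t * q t).

Definition affine_fspace (K : closedFieldType) (T : Type) (X : set (T -> K)) :
    fspace K := @FSpace K T
  [set U | forall t, U t -> exists p,
     [/\ polyfun X p, p t != 0 & forall u, p u != 0 -> U u]]
  (fun U => [set f | forall t, U t -> exists p q,
     [/\ polyfun X p, polyfun X q, q t != 0 &
         forall u, U u -> q u != 0 -> f u = p u / q u]]).

(* The induced structure on a subset: a function is regular when it is locally
   the restriction of a regular function of the ambient space. *)
Definition sub_fspace (K : closedFieldType) (X : fspace K) (S : set X) :
    fspace K := @FSpace K {x : X | S x}
  [set U | exists2 U', zopen X U' & U = sval @^-1` U']
  (fun U => [set f | forall x, U x -> exists U' h,
     [/\ zopen X U', U' (sval x), regular X U' h &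
         forall y, U y -> U' (sval y) -> f y = h (sval y)]]).

Definition orbit_class (T : Type) (E : T -> T -> Prop) (x : T) :
    {c : set T | exists x, c = E x} :=
  exist _ (E x : set T) (ex_intro _ x erefl).

(* The geometric quotient by an orbit equivalence relation [E]: quotient
   topology, and invariant regular functions. *)
Definition quot_fspace (K : closedFieldType) (X : fspace K)
    (E : X -> X -> Prop) : fspace K :=
  @FSpace K {c : set X | exists x, c = E x}
    [set U | zopen X (orbit_class E @^-1` U)]
    (fun U => [set f : {c : set X | exists x, c = E x} -> K |
       regular X (orbit_class E @^-1` U) (f \o orbit_class E)]).

(** Graded dimension vectors *)

(* Dimension vectors are indexed by all of [int] and vanish outside the actual
   range of the index, so that spaces with an index out of range are zero. *)
Definition graded_dimvec (lo hi : int) (v : int -> int -> nat) :=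
  finite_set [set p : int * int | v p.1 p.2 != 0%N] /\
  forall i m, v i m != 0%N -> lo <= i <= hi.

Definition total_dim (v : int -> int -> nat) (i : int) : nat :=
  \big[addn/0%N]_(m \in [set: int]) v i m.

(* Matrices act on column vectors, and [eigenspace] is made of row vectors:
   hence the transpose.  Over [K] algebraically closed, semisimple means
   diagonalizable. *)
Definition semisimple_with_dims (K : closedFieldType) (d : int -> nat)
    (s : forall i, 'M[K]_(d i)) (v : int -> int -> nat) :=
  (forall i, diagonalizable (s i)) /\
  (forall i m, \rank (eigenspace (s i)^T m%:~R) = v i m).

(** Handsaw quiver varieties *)

(* V_i = K^(v i), W_i = K^(w i) for all integers i. *)
Record handsaw (K : closedFieldType) (v w : int -> nat) := Handsaw {
  hB1 : forall i : int, 'M[K]_(v (i + 1), v i);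
  hB2 : forall i : int, 'M[K]_(v i);
  ha : forall i : int, 'M[K]_(v i, w i);
  hb : forall i : int, 'M[K]_(w (i + 1), v i)
}.

Section Handsaw.
Variables (K : closedFieldType) (v w : int -> nat).
Implicit Types (x : handsaw K v w).

Definition handsaw_coord : set (handsaw K v w -> K) :=
  [set c | [\/ exists (i : int) p q, c = fun x => hB1 x i p q,
               exists (i : int) p q, c = fun x => hB2 x i p q,
               exists (i : int) p q, c = fun x => ha x i p q |
               exists (i : int) p q, c = fun x => hb x i p q]].

Definition handsaw_moment x (i : int) : 'M[K]_(v (i + 1), v i) :=
  hB1 x i *m hB2 x i - hB2 x (i + 1) *m hB1 x i + ha x (i + 1) *m hb x i.

Definition handsaw_stable x :=
  forall S : forall i, {vspace 'cV[K]_(v i)},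
    (forall (i : int) u, u \in S i -> hB1 x i *m u \in S (i + 1)) ->
    (forall (i : int) u, u \in S i -> hB2 x i *m u \in S i) ->
    (forall (i : int) u, ha x i *m u \in S i) ->
    forall i, S i = fullv.

Definition handsaw_act (g : forall i, 'M[K]_(v i)) x : handsaw K v w :=
  Handsaw (fun i : int => g (i + 1) *m hB1 x i *m invmx (g i))
          (fun i : int => g i *m hB2 x i *m invmx (g i))
          (fun i : int => g i *m ha x i)
          (fun i : int => hb x i *m invmx (g i)).

Definition handsaw_space : fspace K :=
  sub_fspace (X := affine_fspace handsaw_coord)
    [set x | (forall i : int, handsaw_moment x i = 0) /\ handsaw_stable x].

Definition handsaw_variety : fspace K :=
  quot_fspace (fun x y : handsaw_space =>
    exists2 g, (forall i, g i \in unitmx) & sval y = handsaw_act g (sval x)).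

(* Derivative at the identity, in the direction (1, s), of
   (t, g).(B1, B2, a, b) = (B1, t B2, a g^-1, t g b). *)
Definition torus_tangent (s : forall i, 'M[K]_(w i)) x : handsaw K v w :=
  Handsaw (fun i : int => 0) (fun i => hB2 x i) (fun i => - (ha x i *m s i))
          (fun i : int => hb x i + s (i + 1) *m hb x i).

(* Derivative at the identity, in the direction eta, of [handsaw_act]. *)
Definition orbit_tangent (eta : forall i, 'M[K]_(v i)) x : handsaw K v w :=
  Handsaw (fun i : int => eta (i + 1) *m hB1 x i - hB1 x i *m eta i)
          (fun i : int => eta i *m hB2 x i - hB2 x i *m eta i)
          (fun i : int => eta i *m ha x i)
          (fun i : int => - (hb x i *m eta i)).

(* The value at the class of x of the vector field of s on the quotient is the
   class of [torus_tangent s x] modulo the tangent space of the orbit of x. *)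
Definition zero_locus (s : forall i, 'M[K]_(w i)) : set handsaw_variety :=
  [set c | exists2 x, sval c x &
     exists eta, torus_tangent s (sval x) = orbit_tangent eta (sval x)].

(* [B1, xi] = 0, [B2, xi] = B2, xi a = a s, b xi = (s + 1) b *)
Definition weight_operator (s : forall i, 'M[K]_(w i)) x
    (xi : forall i, 'M[K]_(v i)) :=
  [/\ forall i : int, hB1 x i *m xi i - xi (i + 1) *m hB1 x i = 0,
      forall i : int, hB2 x i *m xi i - xi i *m hB2 x i = hB2 x i,
      forall i : int, xi i *m ha x i = ha x i *m s i &
      forall i : int, hb x i *m xi i = (s (i + 1) + 1%:M) *m hb x i].

End Handsaw.

(* The eigenspace dimensions of xi are locally constant on the zero locus, so
   the locus where they are given by v is a union of connected components; it
   is contained in the part of the handsaw variety with dim V_i = sum_m v i m. *)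
Definition graded_handsaw_variety (K : closedFieldType) (v : int -> int -> nat)
    (d : int -> nat) (s : forall i, 'M[K]_(d i)) : fspace K :=
  sub_fspace (X := handsaw_variety K (total_dim v) d)
    (zero_locus s `&`
     [set c | exists2 x, sval c x &
        exists2 xi, weight_operator s (sval x) xi & semisimple_with_dims xi v]).

(** Graded quiver varieties of type A *)

(* V'_j(k) = K^(v j k), W'_j(k) = K^(w j k).  The component of B2 from V'_(j+1)(k)
   to V'_j(k-1) is indexed by its target j (and the degree k of its source), so
   that all compositions below typecheck without casts. *)
Record quiverA (K : closedFieldType) (v w : int -> int -> nat) := QuiverA {
  qB1 : forall j k : int, 'M[K]_(v (j + 1) (k - 1), v j k);
  qB2 : forall j k : int, 'M[K]_(v j (k - 1), v (j + 1) k);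
  qa : forall j k : int, 'M[K]_(v j (k - 1), w j k);
  qb : forall j k : int, 'M[K]_(w j (k - 1), v j k)
}.

Section QuiverA.
Variables (K : closedFieldType) (v w : int -> int -> nat).
Implicit Types (x : quiverA K v w).

Definition quiverA_coord : set (quiverA K v w -> K) :=
  [set c | [\/ exists (j k : int) p q, c = fun x => qB1 x j k p q,
               exists (j k : int) p q, c = fun x => qB2 x j k p q,
               exists (j k : int) p q, c = fun x => qa x j k p q |
               exists (j k : int) p q, c = fun x => qb x j k p q]].

(* B1 B2 - B2 B1 + a b on V'_(j+1)(k) *)
Definition quiverA_moment x (j k : int) :
    'M[K]_(v (j + 1) (k - 1 - 1), v (j + 1) k) :=
  qB1 x j (k - 1) *m qB2 x j k - qB2 x (j + 1) (k - 1) *m qB1 x (j + 1) k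
  + qa x (j + 1) (k - 1) *m qb x (j + 1) k.

Definition quiverA_stable x :=
  forall S : forall j k, {vspace 'cV[K]_(v j k)},
    (forall (j k : int) u, u \in S j k -> qB1 x j k *m u \in S (j + 1) (k - 1)) ->
    (forall (j k : int) u, u \in S (j + 1) k -> qB2 x j k *m u \in S j (k - 1)) ->
    (forall (j k : int) u, qa x j k *m u \in S j (k - 1)) ->
    forall j k, S j k = fullv.

Definition quiverA_act (g : forall j k, 'M[K]_(v j k)) x : quiverA K v w :=
  QuiverA (fun j k : int => g (j + 1) (k - 1) *m qB1 x j k *m invmx (g j k))
          (fun j k : int => g j (k - 1) *m qB2 x j k *m invmx (g (j + 1) k))
          (fun j k : int => g j (k - 1) *m qa x j k)
          (fun j k : int => qb x j k *m invmx (g j k)).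

Definition quiverA_space : fspace K :=
  sub_fspace (X := affine_fspace quiverA_coord)
    [set x | (forall j k : int, quiverA_moment x j k = 0) /\ quiverA_stable x].

Definition quiverA_variety : fspace K :=
  quot_fspace (fun x y : quiverA_space =>
    exists2 g, (forall j k, g j k \in unitmx) &
      sval y = quiverA_act g (sval x)).

End QuiverA.

(** The change of grading *)

Definition quiverA_dimV (v : int -> int -> nat) (j k : int) : nat :=
  if (2 %| j - k)%Z then v ((j - k) %/ 2)%Z ((j + k) %/ 2)%Z else 0%N.

Definition quiverA_dimW (w : int -> int -> nat) (j k : int) : nat :=
  if (2 %| j - k + 1)%Z
  then w ((j - k + 1) %/ 2)%Z ((j + k - 1) %/ 2)%Z else 0%N.

(* Main.v *)
Require Import Defs.
From mathcomp Require Import all_boot all_order all_algebra.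
From mathcomp Require Import perm complex ring zify.
From mathcomp Require Import all_classical all_reals.

Set Implicit Arguments.
Unset Strict Implicit.
Unset Printing Implicit Defensive.

Import Order.TTheory GRing.Theory Num.Theory.
Local Open Scope classical_set_scope.
Local Open Scope ring_scope.

(** The weight operator of a class fixed by [s] splits V into weight spaces, and
    in coordinates adapted to the splitting the maps of a handsaw datum are
    exactly the maps of a datum of the quiver of type A.  Assembling the blocks
    is polynomial, so the map from the quiver variety of type A to the graded
    handsaw variety is a morphism.  For the inverse one needs, around each fixed
    class, an extension to an open subset of the whole handsaw variety: by
    stability the vectors [B... a w], with [w] in some W_i(m), provide near a
    fixed point a frame of V that is equivariant, depends regularly on the point
    and consists of weight vectors at fixed points.  Normalizing the frame to the
    standard basis and extracting the blocks is an invariant rational map, which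
    restricts to the inverse. *)

(** * Spaces with functions *)

(** The part of weight m of V_i or W_i gets the indices j = i + m and k = m - i + e, with e = 0 for
    V and e = 1 for W; the shift on W is what makes both a and b lower k by one. Points near a fixed
    class have no weight operator in general, so the frame cannot be read off a grading there. It
    extends because the weight of a word in B1, B2 and a, applied to an eigenvector of [s], depends
    on the word alone: each B2 lowers the eigenvalue by one and B1 preserves it. Orbits correspond
    on the two sides because a stable point has at most one weight operator: a group element
    relating two homogeneous points must preserve their gradings. Both facts rest on the integers
    staying distinct in the field, so that different weights are different eigenvalues. *)

Section SpacesWithFunctions.
Variable K : closedFieldType.
Implicit Types X Y T : fspace K.

(** An [fspace] is raw data; these are the sheaf properties that allow local arguments.
    [regular_glue] also says that regularity on [U] depends only on the values on [U]. *)
Record ringed_axioms X : Prop := RingedAxioms {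
  zopenT : zopen X setT;
  zopenI : forall U V, zopen X U -> zopen X V -> zopen X (U `&` V);
  zopen_local : forall U : set X,
    (forall x, U x -> exists V, [/\ zopen X V, V x & V `<=` U]) -> zopen X U;
  regular_restrict : forall U V f,
    zopen X V -> V `<=` U -> regular X U f -> regular X V f;
  regular_glue : forall U f, zopen X U ->
    (forall x, U x -> exists V h, [/\ zopen X V, V x, regular X V h &
       forall y, U y -> V y -> f y = h y]) -> regular X U f
}.

(** [f] is a total function whose values off [U] are irrelevant, as for a map defined on an open
    part. When the whole target is open, the first clause makes [U] open. *)
Definition morphism_on X Y (U : set X) (f : X -> Y) :=
  forall V, zopen Y V -> zopen X (U `&` f @^-1` V) /\
    forall h, regular Y V h -> regular X (U `&` f @^-1` V) (h \o f).

Lemma morphism_onT X Y (f : X -> Y) : morphism f <-> morphism_on setT f.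
Proof.
split=> [[fo fr] V oV|fT].
  by rewrite setTI; split=> [|h]; [apply: fo|apply: fr].
split=> [V oV|V h oV]; have := fT _ oV; rewrite setTI => -[] // _; exact.
Qed.

Lemma morphism_comp X Y T (f : X -> Y) (g : Y -> T) :
  morphism f -> morphism g -> morphism (g \o f).
Proof.
move=> [fo fr] [go gr]; split=> [V oV|V h oV rh].
  exact: (fo (g @^-1` V) (go _ oV)).
exact: (fr (g @^-1` V) (h \o g) (go _ oV) (gr _ _ oV rh)).
Qed.

Lemma morphism_on_compl X Y T (U : set X) (f : X -> Y) (g : Y -> T) :
  morphism_on U f -> morphism g -> morphism_on U (g \o f).
Proof.
move=> fU [go gr] V oV; have [oU rU] := fU _ (go _ oV).
by split=> // h rh; apply: (rU (h \o g)); apply: gr.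
Qed.

Lemma morphism_on_compr X Y T (U : set Y) (f : X -> Y) (g : Y -> T) :
  morphism f -> morphism_on U g -> morphism_on (f @^-1` U) (g \o f).
Proof.
move=> [fo fr] gU V oV; have [oU rU] := gU _ oV.
split=> [|h rh]; first exact: (fo _ oU).
exact: (fr _ (h \o g) oU (rU _ rh)).
Qed.

Lemma morphism_on_eq X Y (U : set X) (f g : X -> Y) : ringed_axioms X ->
  (forall x, U x -> f x = g x) -> morphism_on U f -> morphism_on U g.
Proof.
move=> aX fg fU V oV; have [oU rU] := fU _ oV.
have UE : U `&` g @^-1` V = U `&` f @^-1` V.
  by apply/seteqP; split=> x [Ux /= Vx]; split=> //=; rewrite ?fg // -fg.
rewrite UE; split=> // h rh; apply: (regular_glue aX) => // x Vx.
exists (U `&` f @^-1` V), (h \o f); split=> //; first exact: rU.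
by move=> y [Uy _] _ /=; rewrite fg.
Qed.

Lemma morphism_local X Y (f : X -> Y) : ringed_axioms X ->
  (forall x, exists U, [/\ U x & morphism_on U f]) -> morphism f.
Proof.
move=> aX floc.
have fo V : zopen Y V -> zopen X (f @^-1` V).
  move=> oV; apply: (zopen_local aX) => x Vx; have [U [Ux fU]] := floc x.
  by exists (U `&` f @^-1` V); split=> //; have [] := fU _ oV.
split=> // V h oV rh; apply: (regular_glue aX); first exact: fo.
move=> x Vx; have [U [Ux fU]] := floc x; have [oU rU] := fU _ oV.
by exists (U `&` f @^-1` V), (h \o f); split=> //; apply: rU.
Qed.

(** * Induced structures on subsets *)

Section Sub.
Variables (X : fspace K) (S : set X).
Hypothesis aX : ringed_axioms X.

Lemma sub_ringed : ringed_axioms (sub_fspace S).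
Proof.
split.
- by exists setT => //; apply: zopenT.
- move=> _ _ [U oU ->] [V oV ->]; exists (U `&` V) => //.
  exact: zopenI.
- move=> U Uloc.
  exists [set x | exists V, [/\ zopen X V, V x & sval @^-1` V `<=` U]].
    apply: (zopen_local aX) => x [V [oV Vx VU]].
    by exists V; split=> // y Vy; exists V.
  apply/seteqP; split=> [x Ux|x [V [_ Vx VU]]]; last exact: VU.
  have [_ [[V oV ->] Vx VU]] := Uloc _ Ux.
  by exists V.
- move=> U V f oV VU rf x Vx; have [U' [h [oU' U'x rh fh]]] := rf _ (VU _ Vx).
  by exists U', h; split=> // y Vy U'y; apply: fh => //; apply: VU.
- move=> U f oU floc x Ux; have [_ [h [[V oV ->] Vx rh fh]]] := floc _ Ux.
  have [W [h' [oW Wx rh' hh']]] := rh _ Vx.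
  exists (V `&` W), h'; split=> //; first exact: zopenI.
    by apply: (regular_restrict aX) rh' => //; first exact: zopenI.
  by move=> y Uy [Vy Wy]; rewrite fh // hh'.
Qed.

Lemma morphism_sval : morphism (sval : sub_fspace S -> X).
Proof.
split=> [V oV|V h oV rh]; first by exists V.
by move=> x Vx; exists V, h; split.
Qed.

Lemma morphism_on_sub T (U : set T) (f : T -> X) (g : T -> sub_fspace S) :
  ringed_axioms T -> (forall t, U t -> f t = sval (g t)) ->
  morphism_on U f -> morphism_on U g.
Proof.
move=> aT fg fU _ [V oV ->]; have [oU rU] := fU _ oV.
have UE : U `&` g @^-1` (sval @^-1` V) = U `&` f @^-1` V.
  by apply/seteqP; split=> t [Ut /= Vt]; split=> //=; rewrite ?fg // -fg.
rewrite UE; split=> // h rh; apply: (regular_glue aT) => // t [Ut /= Vt].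
have Vgt : (sval @^-1` V) (g t) by rewrite /= -fg.
have [W [h' [oW Wt rh' hh']]] := rh _ Vgt.
have [oUW rUW] := fU _ oW.
exists (U `&` f @^-1` W), (h' \o f); split=> //; first by split=> //=; rewrite fg.
  exact: rUW.
move=> y [Uy /= Vy] [_ Wy] /=; rewrite hh' ?fg //=; rewrite -fg //.
Qed.

End Sub.

Lemma morphism_sub X (S : set X) T (g : T -> sub_fspace S) :
  ringed_axioms T -> morphism (sval \o g : T -> X) -> morphism g.
Proof.
move=> aT /morphism_onT fT; apply/morphism_onT.
exact: (morphism_on_sub aT (f := sval \o g)).
Qed.

(** * Quotients by an orbit relation *)

Section Quotient.
Variables (X : fspace K) (E : X -> X -> Prop).
Hypothesis aX : ringed_axioms X.

Lemma orbit_classP (c : quot_fspace E) : exists x, c = orbit_class E x.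
Proof. by case: c => c [x cE]; exists x; apply: eq_exist. Qed.

Lemma quot_ringed : ringed_axioms (quot_fspace E).
Proof.
split.
- exact: (zopenT aX).
- by move=> U V; apply: (zopenI aX).
- move=> U Uloc; apply: (zopen_local aX) => x Ux.
  have [V [oV Vx VU]] := Uloc _ Ux.
  by exists (orbit_class E @^-1` V); split=> // y; apply: VU.
- move=> U V f oV VU; apply: (regular_restrict aX) => // x; exact: VU.
- move=> U f oU floc; apply: (regular_glue aX) => // x Ux.
  have [V [h [oV Vx rh fh]]] := floc _ Ux.
  exists (orbit_class E @^-1` V), (h \o orbit_class E); split=> // y Uy Vy.
  exact: fh.
Qed.

(** The quotient structure is defined by pullback along the class map, so this and the next two
    statements hold by conversion. *)
Lemma morphism_orbit_class :
  morphism (orbit_class E : X -> quot_fspace E).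
Proof. by []. Qed.

Lemma morphism_on_quot T (U : set (quot_fspace E)) (f : quot_fspace E -> T) :
  morphism_on (orbit_class E @^-1` U) (f \o orbit_class E : X -> T) ->
  morphism_on U f.
Proof. by []. Qed.

Lemma morphism_quot T (f : quot_fspace E -> T) :
  morphism (f \o orbit_class E : X -> T) -> morphism f.
Proof. by []. Qed.

Hypotheses (Er : forall x, E x x) (Es : forall x y, E x y -> E y x)
  (Et : forall x y z, E x y -> E y z -> E x z).

Lemma orbit_class_eq x y : orbit_class E x = orbit_class E y <-> E x y.
Proof.
split=> [[] ExEy|Exy]; first by rewrite ExEy.
apply: eq_exist; apply/seteqP; split=> z; first exact: (Et (Es Exy)).
exact: Et.
Qed.

End Quotient.

(** * Regular functions and matrices on affine spaces *)

Section Affine.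
Variables (A : Type) (C : set (A -> K)).
Local Notation AC := (affine_fspace C).

Lemma affine_ringed : ringed_axioms AC.
Proof.
split.
- move=> t _; exists (fun=> 1); split=> //; first exact: polyfun_cst.
  exact: oner_neq0.
- move=> U V oU oV t [Ut Vt].
  have [p [pp p0 pU]] := oU _ Ut; have [q [pq q0 qV]] := oV _ Vt.
  exists (fun t => p t * q t); split; first exact: polyfun_mul.
    by rewrite mulf_neq0.
  by move=> u; rewrite mulf_eq0 => /norP[pu qu]; split; [apply: pU|apply: qV].
- move=> U Uloc t Ut; have [V [oV Vt VU]] := Uloc _ Ut.
  have [p [pp p0 pV]] := oV _ Vt.
  by exists p; split=> // u pu; apply/VU/pV.
- move=> U V f oV VU rf t Vt; have [p [q [pp pq q0 fE]]] := rf _ (VU _ Vt).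
  by exists p, q; split=> // u Vu qu; apply: fE => //; apply: VU.
- move=> U f oU floc t Ut; have [V [h [oV Vt rh fh]]] := floc _ Ut.
  have [p [q [pp pq q0 hE]]] := rh _ Vt.
  have [e [pe e0 eV]] := oV _ Vt.
  (* The factor [e] is nonzero only inside [V], so the fraction is compared with [f] only where [f]
     agrees with [h]. *)
  exists (fun t => p t * e t), (fun t => q t * e t).
  split; [exact: polyfun_mul|exact: polyfun_mul|by rewrite mulf_neq0|].
  move=> u Uu; rewrite mulf_eq0 => /norP[qu eu].
  rewrite fh ?hE //; [|exact: eV|exact: eV].
  by rewrite -mulf_div divff // mulr1.
Qed.

Lemma regular_poly U f : polyfun C f -> regular AC U f.
Proof.
move=> pf t Ut; exists f, (fun=> 1); split=> //; first exact: polyfun_cst.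
  exact: oner_neq0.
by move=> u _ _; rewrite divr1.
Qed.

Lemma regular_cst U c : regular AC U (fun=> c).
Proof. exact/regular_poly/polyfun_cst. Qed.

Lemma regularD U f g :
  regular AC U f -> regular AC U g -> regular AC U (fun t => f t + g t).
Proof.
move=> rf rg t Ut.
have [p [q [pp pq q0 fE]]] := rf _ Ut; have [p' [q' [pp' pq' q0' gE]]] := rg _ Ut.
exists (fun t => p t * q' t + p' t * q t), (fun t => q t * q' t).
split; [|exact: polyfun_mul|by rewrite mulf_neq0|].
  by apply: polyfun_add; apply: polyfun_mul.
by move=> u Uu; rewrite mulf_eq0 => /norP[qu qu']; rewrite fE // gE // addf_div.
Qed.

Lemma regularM U f g :
  regular AC U f -> regular AC U g -> regular AC U (fun t => f t * g t).
Proof.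
move=> rf rg t Ut.
have [p [q [pp pq q0 fE]]] := rf _ Ut; have [p' [q' [pp' pq' q0' gE]]] := rg _ Ut.
exists (fun t => p t * p' t), (fun t => q t * q' t).
split; [exact: polyfun_mul|exact: polyfun_mul|by rewrite mulf_neq0|].
by move=> u Uu; rewrite mulf_eq0 => /norP[qu qu']; rewrite fE // gE // mulf_div.
Qed.

Lemma regularV U f : (forall t, U t -> f t != 0) ->
  regular AC U f -> regular AC U (fun t => (f t)^-1).
Proof.
move=> f0 rf t Ut; have [p [q [pp pq q0 fE]]] := rf _ Ut.
(* [q / p] would not do: [f = p / q] is known only where [q] is nonzero, so [q] has to divide the
   denominator. *)
exists (fun t => q t * q t), (fun t => p t * q t).
split; [exact: polyfun_mul|exact: polyfun_mul| |].
  by rewrite mulf_neq0 //; have := f0 _ Ut; rewrite fE // mulf_eq0 => /norP[].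
move=> u Uu; rewrite mulf_eq0 => /norP[pu qu]; rewrite fE //.
by rewrite -mulf_div divff // mulr1 invf_div.
Qed.

Lemma regular_sum U I (r : seq I) (P : pred I) (F : I -> A -> K) :
  (forall i, regular AC U (F i)) ->
  regular AC U (fun t => \sum_(i <- r | P i) F i t).
Proof.
move=> rF; elim: r => [|i r IHr].
  by rewrite (_ : (fun=> _) = fun=> 0) ?funeqE => [|t];
    rewrite ?big_nil //; apply: regular_cst.
under eq_fun do rewrite big_cons.
case: (P i) => //; exact: regularD.
Qed.

Lemma regular_prod U I (r : seq I) (P : pred I) (F : I -> A -> K) :
  (forall i, regular AC U (F i)) ->
  regular AC U (fun t => \prod_(i <- r | P i) F i t).
Proof.
move=> rF; elim: r => [|i r IHr].
  by rewrite (_ : (fun=> _) = fun=> 1) ?funeqE => [|t];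
    rewrite ?big_nil //; apply: regular_cst.
under eq_fun do rewrite big_cons.
case: (P i) => //; exact: regularM.
Qed.

Lemma zopen_regular U f : zopen AC U -> regular AC U f ->
  zopen AC [set t | U t /\ f t != 0].
Proof.
move=> oU rf t [Ut ft].
have [p [q [pp pq q0 fE]]] := rf _ Ut; have [e [pe e0 eU]] := oU _ Ut.
exists (fun t => p t * q t * e t); split.
- by do 2?apply: polyfun_mul.
- rewrite !mulf_neq0 //.
  by move: ft; rewrite fE // mulf_eq0 => /norP[].
- move=> u; rewrite !mulf_eq0 => /norP[/norP[pu qu] eu].
  have Uu := eU _ eu; split=> //.
  by rewrite fE // mulf_neq0 // invr_eq0.
Qed.

Definition regular_mx (U : set A) m n (M : A -> 'M[K]_(m, n)) :=
  forall p q, regular AC U (fun t => M t p q).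

Lemma regular_mx_restrict U V m n (M : A -> 'M[K]_(m, n)) : zopen AC V -> V `<=` U ->
  regular_mx U M -> regular_mx V M.
Proof. by move=> oV VU rM p q; apply: (regular_restrict affine_ringed) (rM p q). Qed.

Lemma regular_mx_cst U m n (M : 'M[K]_(m, n)) : regular_mx U (fun=> M).
Proof. by move=> p q; apply: regular_cst. Qed.

Lemma regular_mxD U m n (M N : A -> 'M[K]_(m, n)) :
  regular_mx U M -> regular_mx U N -> regular_mx U (fun t => M t + N t).
Proof.
by move=> rM rN p q; under eq_fun do rewrite mxE; apply: regularD.
Qed.

Lemma regular_mx_sum U m n I (r : seq I) (P : pred I) (F : I -> A -> 'M[K]_(m, n)) :
  (forall i, regular_mx U (F i)) ->
  regular_mx U (fun t => \sum_(i <- r | P i) F i t).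
Proof.
move=> rF p q; under eq_fun do rewrite summxE.
by apply: (@regular_sum _ _ _ _ (fun i t => F i t p q)) => i; apply: rF.
Qed.

Lemma regular_mxM U m n l (M : A -> 'M[K]_(m, n)) (N : A -> 'M[K]_(n, l)) :
  regular_mx U M -> regular_mx U N -> regular_mx U (fun t => M t *m N t).
Proof.
move=> rM rN p q; under eq_fun do rewrite mxE.
by apply: (@regular_sum _ _ _ _ (fun i t => M t p i * N t i q)) => i; apply: regularM.
Qed.

Lemma regular_det U n (M : A -> 'M[K]_n) :
  regular_mx U M -> regular AC U (fun t => \det (M t)).
Proof.
move=> rM; rewrite /determinant.
apply: (@regular_sum _ _ _ _ (fun (s : {perm 'I_n}) t =>
  (-1) ^+ s * \prod_i M t i (s i))) => s.
apply: regularM; first exact: regular_cst.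
by apply: (@regular_prod _ _ _ _ (fun i t => M t i (s i))) => i; apply: rM.
Qed.

Lemma regular_invmx U n (M : A -> 'M[K]_n) : (forall t, U t -> M t \in unitmx) ->
  regular_mx U M -> regular_mx U (fun t => invmx (M t)).
Proof.
move=> uM rM p q.
have rV : regular AC U (fun t => (\det (M t))^-1 * \adj (M t) p q).
  apply: regularM.
    apply: regularV; last exact: regular_det.
    by move=> t /uM; rewrite unitmxE unitfE.
  under eq_fun do rewrite mxE.
  apply: regularM; first exact: regular_cst.
  by apply: regular_det => p' q'; under eq_fun do rewrite !mxE; apply: rM.
(* [invmx] is given by the adjugate only at invertible matrices, so the fraction is transferred at
   points of [U]. *)
move=> t Ut; have [n' [d [pn pd d0 E]]] := rV _ Ut.
exists n', d; split=> // u Uu du.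
by rewrite -E // /invmx uM // mxE.
Qed.

Lemma morphism_on_affine B (C' : set (B -> K)) U (f : A -> B) : zopen AC U ->
  (forall c, C' c -> regular AC U (c \o f)) ->
  morphism_on (X := AC) (Y := affine_fspace C') U f.
Proof.
move=> oU rc.
have rp p : polyfun C' p -> regular AC U (p \o f).
  elim=> [c|c /rc//|p1 p2 _ r1 _ r2|p1 p2 _ r1 _ r2].
  - exact: regular_cst.
  - exact: (regularD r1 r2).
  - exact: (regularM r1 r2).
have fo V : zopen (affine_fspace C') V -> zopen AC (U `&` f @^-1` V).
  move=> oV; apply: (zopen_local affine_ringed) => t [Ut Vt].
  have [p [pp p0 pV]] := oV _ Vt.
  exists [set t | U t /\ p (f t) != 0]; split=> //.
    exact: (zopen_regular oU (rp _ pp)).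
  by move=> u [Uu pu]; split=> //; apply: pV.
move=> V oV; split; first exact: fo.
move=> h rh; apply: (regular_glue affine_ringed); first exact: fo.
move=> t [Ut Vt]; have [p [q [pp pq q0 hE]]] := rh _ Vt.
have oq := zopen_regular oU (rp _ pq).
exists ((U `&` f @^-1` V) `&` [set t | U t /\ q (f t) != 0]).
have oW := zopenI affine_ringed (fo _ oV) oq.
exists (fun t => p (f t) * (q (f t))^-1); split=> //.
  apply: regularM.
    by apply: (regular_restrict affine_ringed) (rp _ pp) => // u [[]].
  apply: regularV; first by move=> u [_ []].
  by apply: (regular_restrict affine_ringed) (rp _ pq) => // u [[]].
by move=> u [_ Vu] [_ [_ qu]] /=; apply: hE.
Qed.

End Affine.
End SpacesWithFunctions.

(** * Semisimple operators and gradings *)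

(** Stability is tested on [{vspace}], while the subspaces that arise are given by predicates. A
    subspace of maximal dimension inside [P] exhausts [P], since adding the line of a missing vector
    would enlarge it. *)
Lemma vspace_of_linear_set (K : fieldType) (vT : vectType K) (P : set vT) :
  P 0 -> (forall a u v, P u -> P v -> P (a *: u + v)) ->
  exists U : {vspace vT}, forall u, u \in U <-> P u.
Proof.
move=> P0 PL.
pose Q d := `[< exists2 U : {vspace vT}, \dim U = d & forall u, u \in U -> P u >].
have exQ : exists d, Q d.
  exists 0%N; apply/asboolP; exists 0%VS; rewrite ?dimv0 // => u.
  by rewrite memv0 => /eqP->.
have ubQ d : Q d -> (d <= \dim (fullv : {vspace vT}))%N.
  by move=> /asboolP[U <- _]; rewrite dimvS ?subvf.
case: (ex_maxnP exQ ubQ) => d /asboolP[U dU UP] dmax.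
exists U => u; split=> [/UP//|Pu].
have : Q (\dim (U + <[u]>)).
  apply/asboolP; exists (U + <[u]>)%VS => // x /memv_addP[y yU [z /vlineP[a ->]]] ->.
  by rewrite addrC; apply: PL => //; apply: UP.
move=> /dmax; rewrite -dU => le; have UuE : U = (U + <[u]>)%VS.
  by apply/eqP; rewrite eqEdim addvSl.
by rewrite UuE; apply: (subvP (addvSr U <[u]>)); apply: memv_line.
Qed.

Lemma rank_diag_mx (K : fieldType) n (d : 'rV[K]_n) :
  \rank (diag_mx d) = (\sum_p (d 0%R p != 0%R))%N.
Proof.
elim: n d => [|n IHn] d; first by rewrite thinmx0 mxrank0 big_ord0.
move: d; rewrite -[n.+1]/(1 + n)%N => d.
rewrite -[d]hsubmxK diag_mx_row rank_diag_block_mx IHn big_split_ord /= big_ord1.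
congr (_ + _)%N; last by apply: eq_bigr => p _; rewrite row_mxEr.
rewrite row_mxEl rank_rV; congr (nat_of_bool (~~ _)).
apply/eqP/eqP => [/matrixP/(_ 0 0)|d0]; first by rewrite !mxE eqxx.
by apply/matrixP => p q; rewrite !ord1 mxE eqxx d0 mxE.
Qed.

Section Splitting.
Variables (K : closedFieldType) (n : nat) (s : 'M[K]_n).

Lemma rank_eigenspace_diagonal (P : 'M[K]_n) (d : 'rV_n) a : P \in unitmx ->
  P *m s = diag_mx d *m P -> \rank (eigenspace s^T a) = (\sum_p (d 0%R p == a))%N.
Proof.
move=> uP Ps; rewrite mxrank_ker -tr_scalar_mx -linearB /= mxrank_tr.
have -> : \rank (s - a%:M) = \rank (diag_mx (d - const_mx a)).
  rewrite -(mxrankMfree (diag_mx _) (B := P)) ?row_free_unit //.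
  rewrite linearB mulmxBl /= -Ps diag_const_mx -scalar_mxC -mulmxBr.
  by rewrite eqmxMfull ?row_full_unit.
rewrite rank_diag_mx; under eq_bigr do rewrite !mxE subr_eq0.
rewrite -[X in (X - _)%N]card_ord -sum1_card.
have -> : (\sum_(p in 'I_n) 1 =
    \sum_p (d 0%R p == a) + \sum_p (d 0%R p != a))%N.
  by rewrite -big_split; apply: eq_bigr => p _ /=; case: (_ == _).
by rewrite addnK.
Qed.

(* The eigenvalues of [s] counted by [v] exhaust the dimension, so [s] splits
   into its eigenspaces for the integers of [r]. *)
Lemma semisimple_splitting (v : int -> nat) (r : seq int) :
  injective (fun m : int => m%:~R : K) -> uniq r -> diagonalizable s ->
  (forall m, \rank (eigenspace s^T m%:~R) = v m) -> n = (\sum_(m <- r) v m)%N ->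
  exists (inc : forall m, 'M[K]_(n, v m)) (proj : forall m, 'M[K]_(v m, n)),
    [/\ forall m, proj m *m inc m = 1%:M,
        forall m m', m != m' -> proj m *m inc m' = 0,
        \sum_(m <- r) inc m *m proj m = 1%:M &
        forall m, s *m inc m = m%:~R *: inc m].
Proof.
move=> hK ur [P uP /similar_diagPex[d /(similarP uP) Ps]] rk nE.
have cardI m : #|[pred p | d 0 p == m%:~R]| = v m.
  rewrite -rk (rank_eigenspace_diagonal _ uP Ps) -sum1_card big_mkcond /=.
  by apply: eq_bigr => p _; rewrite inE; case: eqP.
(* [f m] enumerates the positions of the eigenvalue [m]; the matching columns of [invmx P] form a
   basis of its eigenspace. *)
pose f m (q : 'I_(v m)) : 'I_n := enum_val (cast_ord (esym (cardI m)) q).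
have fP m q : d 0 (f m q) = m%:~R.
  by apply/eqP; have := enum_valP (cast_ord (esym (cardI m)) q).
have fI m : injective (f m) by move=> q q' /enum_val_inj/cast_ord_inj.
exists (fun m => colsub (f m) (invmx P)), (fun m => rowsub (f m) P); split.
- move=> m; rewrite -mxsub_mul mulmxV //.
  by apply/matrixP => p q; rewrite !mxE (inj_eq (@fI m)).
- move=> m m' mm'; rewrite -mxsub_mul mulmxV //.
  apply/matrixP => p q; rewrite !mxE; case: eqP => // ff.
  by case/eqP: mm'; apply: hK; rewrite -(fP _ p) -(fP _ q) ff.
(* [h p] counts the integers of [r] equal to the [p]-th eigenvalue. Each [h p] is at most 1 and they
   add up to [n], so all are 1. *)
- pose h p := (\sum_(m <- r) (d 0%R p == m%:~R))%N.
  have h1 p : (h p <= 1)%N.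
    have -> : h p = count (fun m => d 0 p == m%:~R) r.
      by rewrite -sum1_count big_mkcond; apply: eq_bigr => m _; case: eqP.
    have [/hasP[m0 _ /eqP dm0]|] := boolP (has (fun m => d 0 p == m%:~R) r).
      rewrite (leq_trans (sub_count (a2 := pred1 m0) _ r)) ?count_uniq_mem ?leq_b1 //.
      by move=> m /=; rewrite dm0 => /eqP/hK->.
    by rewrite has_count -leqNgt => /leq_trans->.
  have hE p : h p = 1%N.
    have le p' : true -> (h p' <= 1 ?= iff (h p' == 1))%N by split.
    have [_ /esym] := leqif_sum le.
    suff -> : (\sum_p h p = \sum_(p < n) 1)%N.
      by rewrite eqxx => /forallP/(_ p)/eqP.
    rewrite exchange_big sum1_card card_ord; apply: etrans (esym nE).
    apply: eq_bigr => m _.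
    by rewrite -(rank_eigenspace_diagonal _ uP Ps).
  rewrite -(mulVmx uP); apply/matrixP => a b; rewrite summxE mxE.
  transitivity (\sum_p (invmx P a p * P p b) *+ h p); last first.
    by apply: eq_bigr => p _; rewrite hE.
  under [RHS]eq_bigr do rewrite /h -sumrMnr.
  rewrite exchange_big; apply: eq_bigr => m _ /=; rewrite mxE.
  rewrite [RHS](eq_bigr (fun p => if d 0 p == m%:~R then invmx P a p * P p b else 0));
    last by move=> p _; case: eqP.
  rewrite -big_mkcond /=.
  transitivity (\sum_(p in [pred p | d 0 p == m%:~R]) invmx P a p * P p b) => //.
  (* Replacing [v m] by the cardinality turns [cast_ord] into the identity. *)
  rewrite /f; case: _ / (cardI m); rewrite [RHS]big_enum_val.
  by apply: eq_bigr => q _; rewrite !mxE cast_ord_id.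
- move=> m.
  have -> : s = invmx P *m diag_mx d *m P by rewrite -mulmxA -Ps mulKmx.
  rewrite mulmx_colsub mulmxK // mul_mx_diag; apply/matrixP => p q.
  by rewrite !mxE fP mulrC.
Qed.
End Splitting.

Lemma dep_choice (I : Type) (T : I -> Type) (P : forall i, T i -> Prop) :
  (forall i, exists x, P i x) -> exists f : forall i, T i, forall i, P i (f i).
Proof. by move=> h; exists (fun i => sval (cid (h i))) => i; case: cid. Qed.

Lemma total_dim_seq (v : int -> int -> nat) :
  finite_set [set p : int * int | v p.1 p.2 != 0%N] ->
  exists r : seq int, [/\ uniq r, forall i m, m \notin r -> v i m = 0%N &
    forall i, total_dim v i = (\sum_(m <- r) v i m)%N].
Proof.
move=> /finite_seqP[S vS]; exists (undup [seq p.2 | p <- S]).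
have v0 i m : m \notin undup [seq p.2 | p <- S] -> v i m = 0%N.
  rewrite mem_undup => mS; apply/eqP/negP => vim; move/negP: mS; apply.
  have : [set p : int * int | v p.1 p.2 != 0%N] (i, m) by apply/negP.
  by rewrite vS => /= imS; apply/mapP; exists (i, m).
split=> [|//|i]; first exact: undup_uniq.
rewrite fsbig_seq ?undup_uniq //; apply/esym/fsbig_widen => // m [_ /= mr].
by apply: v0; apply/negP.
Qed.

(** Supplies a reference operator, to which the weight operators of all fixed points are later
    conjugated. Its diagonal lists each weight [m] with multiplicity [v i m]. *)
Lemma exists_semisimple (K : closedFieldType) (v : int -> int -> nat) :
  injective (fun m : int => m%:~R : K) ->
  finite_set [set p : int * int | v p.1 p.2 != 0%N] ->
  exists s : forall i, 'M[K]_(total_dim v i), semisimple_with_dims s v.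
Proof.
move=> hK fv; have [r [ur vr0 vr]] := total_dim_seq fv.
pose L i := flatten [seq nseq (v i m) m | m <- r].
have sL i : size (L i) = total_dim v i.
  rewrite vr size_flatten /shape -map_comp sumnE big_map.
  by apply: eq_bigr => m _ /=; rewrite size_nseq.
exists (fun i => diag_mx (\row_p (nth 0 (L i) p)%:~R)); split=> [i|i m].
  exact: diagonalizable_diag.
rewrite (rank_eigenspace_diagonal (P := 1%:M)
  (d := \row_p (nth 0 (L i) p)%:~R)) ?unitmx1 ?mul1mx ?mulmx1 //.
under eq_bigr do rewrite mxE (inj_eq hK).
rewrite -(big_mkord xpredT (fun p => nth 0%R (L i) p == m : nat)) -{1}sL.
rewrite -(big_nth 0 xpredT (fun x => x == m : nat)) /L big_flatten big_map /=.
under eq_bigr do rewrite big_nseq iter_addn addn0.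
have [mr|mr] := boolP (m \in r).
  rewrite (bigD1_seq m) //= eqxx mul1n big1 ?addn0 // => m' /negbTE->.
  by rewrite mul0n.
rewrite big1_seq => [|m' /andP[_ m'r]]; first by rewrite vr0.
by rewrite (_ : m' == m = false) //; apply: contraNF mr => /eqP<-.
Qed.

(* [gin i j k] and [gout i j k] are the inclusion of the (j, k)-component of the
   type A spaces into the i-th handsaw space and the projection onto it.  That
   component is the eigenspace of [s i] for j - i when j - k + e = 2i, and both
   maps are zero for the other [i]; e is 0 for V and 1 for W.  Keeping the three
   indices independent avoids all casts. *)
Record grading (K : closedFieldType) (N : int -> nat) (s : forall i, 'M[K]_(N i))
    (D : int -> int -> nat) (e : int) := Grading {
  gsupp : seq int;
  gin : forall i j k, 'M[K]_(N i, D j k);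
  gout : forall i j k, 'M[K]_(D j k, N i);
  gin_off : forall i j k, j - k + e != i + i -> gin i j k = 0;
  gout_off : forall i j k, j - k + e != i + i -> gout i j k = 0;
  ginK : forall i j k, j - k + e = i + i -> gout i j k *m gin i j k = 1%:M;
  gout_gin0 : forall i j k j' k', j != j' -> gout i j k *m gin i j' k' = 0;
  gsum : forall i,
    \sum_(m <- gsupp) gin i (i + m) (m - i + e) *m gout i (i + m) (m - i + e)
      = 1%:M;
  gsupp_uniq : uniq gsupp;
  gin_eigen : forall i j k, s i *m gin i j k = (j - i)%:~R *: gin i j k;
  gdim0 : forall j k, (forall i, j - k + e != i + i) -> D j k = 0%N
}.

Section Conform.
Variables (K : closedFieldType) (n : nat).

(** Blocks of size [v i (j - i)] must be read as blocks of size [D j k], which is equal to it only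
    propositionally. Under the assumed equations the default 0 of [conform_mx] never occurs. *)
Lemma conform_mxM p p' l l' (A : 'M[K]_(p, n)) (B : 'M[K]_(n, l)) :
  p = p' -> l = l' ->
  conform_mx (0 : 'M_(p', n)) A *m conform_mx (0 : 'M_(n, l')) B
    = conform_mx 0 (A *m B).
Proof. by move=> <- <-; rewrite !conform_mx_id. Qed.

Lemma conform_mxM_inner p p' (A : 'M[K]_(p, n)) (B : 'M[K]_(n, p)) : p = p' ->
  conform_mx (0 : 'M_(n, p')) B *m conform_mx (0 : 'M_(p', n)) A = B *m A.
Proof. by move=> <-; rewrite !conform_mx_id. Qed.

Lemma conform_mxZ p p' a (S : 'M[K]_n) (B : 'M[K]_(n, p)) : p = p' ->
  S *m B = a *: B ->
  S *m conform_mx (0 : 'M_(n, p')) B = a *: conform_mx (0 : 'M_(n, p')) B.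
Proof. by move=> <-; rewrite !conform_mx_id. Qed.

End Conform.

Lemma semisimple_grading (K : closedFieldType) (v : int -> int -> nat)
    (s : forall i, 'M[K]_(total_dim v i)) (D : int -> int -> nat) (e : int) :
  injective (fun m : int => m%:~R : K) ->
  finite_set [set p : int * int | v p.1 p.2 != 0%N] ->
  semisimple_with_dims s v ->
  (forall i j k, j - k + e = i + i -> D j k = v i (j - i)) ->
  (forall j k, (forall i, j - k + e != i + i) -> D j k = 0%N) ->
  inhabited (grading s D e).
Proof.
move=> hK fv [ds rs] Dv D0.
have [r [ur _ vr]] := total_dim_seq fv.
have /dep_choice : forall i, exists incproj :
    (forall m, 'M[K]_(total_dim v i, v i m)) * (forall m, 'M[K]_(v i m, total_dim v i)),
    [/\ forall m, incproj.2 m *m incproj.1 m = 1%:M,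
        forall m m', m != m' -> incproj.2 m *m incproj.1 m' = 0,
        \sum_(m <- r) incproj.1 m *m incproj.2 m = 1%:M &
        forall m, s i *m incproj.1 m = m%:~R *: incproj.1 m].
  move=> i; have [inc [proj P]] := semisimple_splitting hK ur (ds i) (rs i) (vr i).
  by exists (inc, proj).
move=> [ip ipP].
pose gi i j k : 'M[K]_(total_dim v i, D j k) :=
  if j - k + e == i + i then conform_mx 0 ((ip i).1 (j - i)) else 0.
pose go i j k : 'M[K]_(D j k, total_dim v i) :=
  if j - k + e == i + i then conform_mx 0 ((ip i).2 (j - i)) else 0.
constructor; apply: (@Grading _ _ s D e r gi go).
- by move=> i j k /negbTE jk; rewrite /gi jk.
- by move=> i j k /negbTE jk; rewrite /go jk.
- move=> i j k jk; rewrite /gi /go jk eqxx; have [ipK _ _ _] := ipP i.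
  have E := Dv _ _ _ jk; rewrite conform_mxM // ipK.
  by case: _ / E; rewrite conform_mx_id.
- move=> i j k j' k' jj'; rewrite /gi /go.
  have [/Dv E|] := eqVneq; last by rewrite mul0mx.
  have [/Dv E'|] := eqVneq; last by rewrite mulmx0.
  have [_ ip0 _ _] := ipP i; rewrite conform_mxM // ip0 ?(inj_eq (addIr _)) //.
  by case: _ / E; case: _ / E'; rewrite conform_mx_id.
- move=> i; have [_ _ ip1 _] := ipP i; rewrite -ip1; apply: eq_bigr => m _.
  have E : i + m - (m - i + e) + e = i + i by ring.
  by rewrite /gi /go E eqxx conform_mxM_inner ?(Dv i) // addrC addKr.
- exact: ur.
- move=> i j k; rewrite /gi; have [/Dv E|] := eqVneq; last by rewrite mulmx0 scaler0.
  by apply: conform_mxZ => //; have [_ _ _] := ipP i.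
- exact: D0.
Qed.

(** * Assembling and extracting blocks *)

Lemma mx_col0 (R : nmodType) m n (A B : 'M[R]_(m, n)) : n = 0%N -> A = B.
Proof. by move=> n0; move: A B; rewrite n0 => A B; rewrite [A]thinmx0 [B]thinmx0. Qed.

Lemma mx_row0 (R : nmodType) m n (A B : 'M[R]_(m, n)) : m = 0%N -> A = B.
Proof. by move=> m0; move: A B; rewrite m0 => A B; rewrite [A]flatmx0 [B]flatmx0. Qed.

(** * Calculus of inclusions and projections of a grading *)

Section GradingTheory.
Variables (K : closedFieldType) (N : int -> nat) (s : forall i, 'M[K]_(N i)).
Variables (D : int -> int -> nat) (e : int) (G : grading s D e).

Lemma gin_epi i q (A B : 'M_(q, N i)) :
  (forall j k, A *m gin G i j k = B *m gin G i j k) -> A = B.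
Proof.
move=> AB; rewrite -[A]mulmx1 -[B]mulmx1 -(gsum G) !mulmx_sumr.
by apply: eq_bigr => m _; rewrite !mulmxA AB.
Qed.

(** The shifted index is the form in which [qB2] and the moment map present their source. *)
Lemma gin_epiS i q (A B : 'M_(q, N i)) :
  (forall j k, A *m gin G i (j + 1) k = B *m gin G i (j + 1) k) -> A = B.
Proof. by move=> AB; apply: gin_epi => j k; rewrite -(subrK 1 j). Qed.

Lemma gout_mono i q (A B : 'M_(N i, q)) :
  (forall j k, gout G i j k *m A = gout G i j k *m B) -> A = B.
Proof.
move=> AB; rewrite -[A]mul1mx -[B]mul1mx -(gsum G) !mulmx_suml.
by apply: eq_bigr => m _; rewrite -!mulmxA AB.
Qed.

Lemma gout_gin_neq i j k j' k' :
  (j, k) != (j', k') -> gout G i j k *m gin G i j' k' = 0.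
Proof.
have [<-|jj' _] := eqVneq j j'; last exact: gout_gin0.
rewrite xpair_eqE eqxx /= => kk'; have [jk|jk] := eqVneq (j - k + e) (i + i).
  by rewrite gin_off ?mulmx0 //; apply: contraNneq kk' => jk'; lia.
by rewrite gout_off ?mul0mx.
Qed.

Lemma gout_eigen i j k : gout G i j k *m s i = (j - i)%:~R *: gout G i j k.
Proof.
apply: gin_epi => j' k'; rewrite -mulmxA gin_eigen -scalemxAr -scalemxAl.
by have [->//|jj'] := eqVneq j j'; rewrite gout_gin0 // !scaler0.
Qed.

(** [J] is equal to [i + m] only propositionally: the source index of [qB2] comes as
    [i + m - 1 + 1], and an abstract [J] accepts it without a cast. *)
Lemma glue_gin i q (J : int -> int) (T : forall m, 'M_(q, D (J m) (m - i + e))) m0 :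
  (forall m, J m = i + m) ->
  (\sum_(m <- gsupp G) T m *m gout G i (J m) (m - i + e))
     *m gin G i (J m0) (m0 - i + e) = T m0.
Proof.
move=> hJ; rewrite mulmx_suml.
have JK m : J m - (m - i + e) + e = i + i by rewrite hJ; ring.
have J0 m m' : m != m' -> gout G i (J m) (m - i + e) *m gin G i (J m') (m' - i + e) = 0.
  by move=> mm'; rewrite gout_gin0 // !hJ (inj_eq (addrI i)).
have [mG|mG] := boolP (m0 \in gsupp G).
  rewrite (bigD1_seq m0) ?gsupp_uniq //= -mulmxA ginK // mulmx1 big1 ?addr0 //.
  by move=> m mm0; rewrite -mulmxA J0 // mulmx0.
(* Off the support the component itself is zero: its identity factors through this vanishing
   inclusion. *)
have g0 : gin G i (J m0) (m0 - i + e) = 0.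
  rewrite -[LHS]mul1mx -(gsum G i) mulmx_suml big1_seq // => m /andP[_ mS].
  rewrite -mulmxA gout_gin0 ?mulmx0 // hJ (inj_eq (addrI i)).
  by apply: contraNneq mG => <-.
rewrite big1 => [|m _]; last by rewrite g0 mulmx0.
by rewrite -[RHS]mulmx1 -(ginK G (JK m0)) g0 !mulmx0.
Qed.

(** The projection of [A] to any other component is an eigenvector for two different integers at
    once, hence zero. *)
Lemma gin_goutK i j k q (A : 'M_(N i, q)) :
  injective (fun m : int => m%:~R : K) -> j - k + e = i + i ->
  s i *m A = (j - i)%:~R *: A -> gin G i j k *m gout G i j k *m A = A.
Proof.
move=> hK jk sA; apply: gout_mono => j' k'; rewrite !mulmxA.
have [jj'|jj'] := eqVneq j' j.
  subst j'; have [->|kk'] := eqVneq k' k; first by rewrite ginK // mul1mx.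
  by rewrite gout_off ?mul0mx //; apply: contraNneq kk' => jk'; lia.
rewrite gout_gin0 // !mul0mx; apply/esym/eqP.
have /eqP : (j' - i)%:~R *: (gout G i j' k' *m A) = (j - i)%:~R *: (gout G i j' k' *m A).
  by rewrite scalemxAl -gout_eigen -mulmxA sA scalemxAr.
rewrite -subr_eq0 -scalerBl scaler_eq0 subr_eq0 (inj_eq hK) (inj_eq (addIr _)).
by rewrite (negbTE jj').
Qed.

Definition gact (h : forall j k, 'M[K]_(D j k)) i : 'M[K]_(N i) :=
  \sum_(m <- gsupp G) gin G i (i + m) (m - i + e) *m h _ _
    *m gout G i (i + m) (m - i + e).

Lemma gact_gin h i j k : gact h i *m gin G i j k = gin G i j k *m h j k.
Proof.
have [jk|jk] := eqVneq (j - k + e) (i + i); last first.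
  by rewrite gin_off // mulmx0 mul0mx.
have := @glue_gin i _ (fun m => i + m)
  (fun m => gin G i (i + m) (m - i + e) *m h (i + m) (m - i + e)) (j - i) (fun=> erefl).
have -> : i + (j - i) = j by ring.
by have -> : j - i - i + e = k by lia.
Qed.

Lemma gact_unit h i : (forall j k, h j k \in unitmx) -> gact h i \in unitmx.
Proof.
move=> uh.
have [|//] := @mulmx1_unit _ _ (gact h i) (gact (fun j k => invmx (h j k)) i).
apply: gin_epi => j k; rewrite -mulmxA gact_gin mulmxA gact_gin -mulmxA.
by rewrite mulmxV // mul1mx mulmx1.
Qed.

Lemma invmx_gact_gin h i j k : (forall j k, h j k \in unitmx) ->
  invmx (gact h i) *m gin G i j k = gin G i j k *m invmx (h j k).
Proof.
move=> uh; rewrite -[gin G i j k in LHS](mulmxK (uh j k)) -gact_gin.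
by rewrite !mulmxA mulVmx ?gact_unit // mul1mx.
Qed.

End GradingTheory.

(** * Correspondence between handsaw data and type A data *)

Section Assembly.
Variables (K : closedFieldType) (N NW : int -> nat) (DV DW : int -> int -> nat).
Variables (xi : forall i, 'M[K]_(N i)) (s : forall i, 'M[K]_(NW i)).
Variables (GV : grading xi DV 0) (GW : grading s DW 1).
Hypothesis intr_inj : injective (fun m : int => m%:~R : K).
Implicit Types (x : handsaw K N NW) (y : quiverA K DV DW).

(** Equations on the inclusions transfer the moment map, stability and the action without any
    formula for the blocks. Each of [x] and [y] determines the other through them. *)
Record intertwines x y : Prop := Intertwines {
  intB1 : forall i j k, hB1 x i *m gin GV i j k
    = gin GV (i + 1) (j + 1) (k - 1) *m qB1 y j k;
  intB2 : forall i j k, hB2 x i *m gin GV i (j + 1) k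
    = gin GV i j (k - 1) *m qB2 y j k;
  inta : forall i j k, ha x i *m gin GW i j k = gin GV i j (k - 1) *m qa y j k;
  intb : forall i j k, hb x i *m gin GV i j k
    = gin GW (i + 1) j (k - 1) *m qb y j k
}.

(** Indices such as [m - i + 0] and [i + m - 1 + 1] are left unsimplified so that neighbouring
    factors have matching types. *)
Definition assemble y : handsaw K N NW := Handsaw
  (fun i => \sum_(m <- gsupp GV)
     gin GV (i + 1) (i + m + 1) (m - i + 0 - 1) *m qB1 y (i + m) (m - i + 0)
       *m gout GV i (i + m) (m - i + 0))
  (fun i => \sum_(m <- gsupp GV)
     gin GV i (i + m - 1) (m - i + 0 - 1) *m qB2 y (i + m - 1) (m - i + 0)
       *m gout GV i (i + m - 1 + 1) (m - i + 0))
  (fun i => \sum_(m <- gsupp GW)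
     gin GV i (i + m) (m - i + 1 - 1) *m qa y (i + m) (m - i + 1)
       *m gout GW i (i + m) (m - i + 1))
  (fun i => \sum_(m <- gsupp GV)
     gin GW (i + 1) (i + m) (m - i + 0 - 1) *m qb y (i + m) (m - i + 0)
       *m gout GV i (i + m) (m - i + 0)).

(** The division recovers the one index [i] whose space contains the source component. When the
    parity is wrong it is meaningless, but then that component is zero. *)
Definition extract x : quiverA K DV DW := QuiverA
  (fun j k => let i := ((j - k) %/ 2)%Z in
     gout GV (i + 1) (j + 1) (k - 1) *m hB1 x i *m gin GV i j k)
  (fun j k => let i := ((j + 1 - k) %/ 2)%Z in
     gout GV i j (k - 1) *m hB2 x i *m gin GV i (j + 1) k)
  (fun j k => let i := ((j - k + 1) %/ 2)%Z in
     gout GV i j (k - 1) *m ha x i *m gin GW i j k)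
  (fun j k => let i := ((j - k) %/ 2)%Z in
     gout GW (i + 1) j (k - 1) *m hb x i *m gin GV i j k).

Lemma assembleP y : intertwines (assemble y) y.
Proof.
split=> i j k /=.
- have [jk|jk] := eqVneq (j - k + 0) (i + i); last first.
    by rewrite !gin_off ?mulmx0 ?mul0mx //; lia.
  have := @glue_gin _ _ _ _ _ GV i _ (fun m => i + m)
    (fun m => gin GV (i + 1) (i + m + 1) (m - i + 0 - 1) *m qB1 y (i + m) (m - i + 0))
    (j - i) (fun=> erefl).
  have -> : i + (j - i) = j by ring.
  by have -> : j - i - i + 0 = k by lia.
- have [jk|jk] := eqVneq (j + 1 - k + 0) (i + i); last first.
    by rewrite !gin_off ?mulmx0 ?mul0mx //; lia.
  have := @glue_gin _ _ _ _ _ GV i _ (fun m => i + m - 1 + 1)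
    (fun m => gin GV i (i + m - 1) (m - i + 0 - 1) *m qB2 y (i + m - 1) (m - i + 0))
    (j + 1 - i) (fun m => subrK 1 (i + m)).
  have -> : i + (j + 1 - i) - 1 = j by ring.
  by have -> : j + 1 - i - i + 0 = k by lia.
- have [jk|jk] := eqVneq (j - k + 1) (i + i); last first.
    by rewrite !gin_off ?mulmx0 ?mul0mx //; lia.
  have := @glue_gin _ _ _ _ _ GW i _ (fun m => i + m)
    (fun m => gin GV i (i + m) (m - i + 1 - 1) *m qa y (i + m) (m - i + 1))
    (j - i) (fun=> erefl).
  have -> : i + (j - i) = j by ring.
  by have -> : j - i - i + 1 = k by lia.
- have [jk|jk] := eqVneq (j - k + 0) (i + i); last first.
    by rewrite !gin_off ?mulmx0 ?mul0mx //; lia.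
  have := @glue_gin _ _ _ _ _ GV i _ (fun m => i + m)
    (fun m => gin GW (i + 1) (i + m) (m - i + 0 - 1) *m qb y (i + m) (m - i + 0))
    (j - i) (fun=> erefl).
  have -> : i + (j - i) = j by ring.
  by have -> : j - i - i + 0 = k by lia.
Qed.

Lemma handsaw_eq x x' : (forall i, hB1 x i = hB1 x' i) ->
  (forall i, hB2 x i = hB2 x' i) -> (forall i, ha x i = ha x' i) ->
  (forall i, hb x i = hb x' i) -> x = x'.
Proof.
case: x x' => [b1 b2 a b] [b1' b2' a' b'] /= E1 E2 Ea Eb.
by congr Handsaw; apply: functional_extensionality_dep.
Qed.

Lemma quiverA_eq y y' : (forall j k, qB1 y j k = qB1 y' j k) ->
  (forall j k, qB2 y j k = qB2 y' j k) -> (forall j k, qa y j k = qa y' j k) ->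
  (forall j k, qb y j k = qb y' j k) -> y = y'.
Proof.
case: y y' => [b1 b2 a b] [b1' b2' a' b'] /= E1 E2 Ea Eb.
by congr QuiverA; apply: functional_extensionality_dep => j;
  apply: functional_extensionality_dep.
Qed.

Lemma intertwines_injl x x' y : intertwines x y -> intertwines x' y -> x = x'.
Proof.
move=> X X'; apply: handsaw_eq => i.
- by apply: (gin_epi (G := GV)) => j k; rewrite (intB1 X) (intB1 X').
- by apply: (gin_epiS (G := GV)) => j k; rewrite (intB2 X) (intB2 X').
- by apply: (gin_epi (G := GW)) => j k; rewrite (inta X) (inta X').
- by apply: (gin_epi (G := GV)) => j k; rewrite (intb X) (intb X').
Qed.

Lemma parity_dim (e : int) (M : int -> nat) (t : forall i, 'M[K]_(M i)) D
    (G : grading t D e) j k :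
  j - k + e = ((j - k + e) %/ 2)%Z + ((j - k + e) %/ 2)%Z \/ D j k = 0%N.
Proof.
have [/dvdzP[i jk]|nd] := boolP (2 %| j - k + e)%Z.
  by left; rewrite jk mulzK //; lia.
right; apply: (gdim0 G) => i; apply: contraNneq nd => ->.
by apply/dvdzP; exists i; lia.
Qed.

Lemma extract_intertwines x y : intertwines x y -> extract x = y.
Proof.
move=> X; apply: quiverA_eq => j k /=.
- have [|d0] := parity_dim GV j k; last exact: mx_col0.
  rewrite addr0; move: ((j - k) %/ 2)%Z => i jk.
  by rewrite -mulmxA (intB1 X) mulmxA ginK ?mul1mx //; lia.
- have [|d0] := parity_dim GV (j + 1) k; last exact: mx_col0.
  rewrite addr0; move: ((j + 1 - k) %/ 2)%Z => i jk.
  by rewrite -mulmxA (intB2 X) mulmxA ginK ?mul1mx //; lia.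
- have [|d0] := parity_dim GW j k; last exact: mx_col0.
  move: ((j - k + 1) %/ 2)%Z => i jk.
  by rewrite -mulmxA (inta X) mulmxA ginK ?mul1mx //; lia.
- have [|d0] := parity_dim GV j k; last exact: mx_col0.
  rewrite addr0; move: ((j - k) %/ 2)%Z => i jk.
  by rewrite -mulmxA (intb X) mulmxA ginK ?mul1mx //; lia.
Qed.

Lemma intertwines_weight x y : intertwines x y -> weight_operator s x xi.
Proof.
move=> X; split=> i.
- apply: (gin_epi (G := GV)) => j k.
  rewrite mulmxBl -!mulmxA gin_eigen (intB1 X) !mulmxA gin_eigen -scalemxAr (intB1 X).
  by rewrite -scalemxAl mul0mx opprD addrACA subrr addr0 subrr.
- apply: (gin_epiS (G := GV)) => j k.
  rewrite mulmxBl -!mulmxA gin_eigen (intB2 X) !mulmxA gin_eigen -scalemxAr (intB2 X).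
  rewrite -scalemxAl -scalerBl -intrB.
  by rewrite (_ : j + 1 - i - (j - i) = 1) ?scale1r //; ring.
- apply: (gin_epi (G := GW)) => j k.
  by rewrite -!mulmxA gin_eigen (inta X) !mulmxA gin_eigen -scalemxAr (inta X) -scalemxAl.
- apply: (gin_epi (G := GV)) => j k.
  rewrite -!mulmxA gin_eigen -scalemxAr (intb X) mulmxA mulmxDl gin_eigen mul1mx.
  rewrite mulmxDl -scalemxAl -[X in _ = _ + X]scale1r -scalerDl -intrD1.
  by congr (_%:~R *: _); ring.
Qed.

(** The weight equations make the image of each component consist of eigenvectors of the expected
    weight, so by [gin_goutK] the projection inside [extract] loses nothing. *)
Lemma weight_intertwines x : weight_operator s x xi -> intertwines x (extract x).
Proof.
move=> [w1 w2 wa wb]; split=> i j k /=.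
- have [jk|jk] := eqVneq (j - k + 0) (i + i); last first.
    by rewrite (gin_off GV jk) mulmx0 [X in _ = X *m _]gin_off ?mul0mx //; lia.
  have -> : ((j - k) %/ 2)%Z = i by rewrite (_ : j - k = i * 2) ?mulzK //; lia.
  rewrite !mulmxA -[in RHS]mulmxA gin_goutK //; first by lia.
  have /eqP := w1 i; rewrite subr_eq0 => /eqP w.
  rewrite mulmxA -w -mulmxA gin_eigen -scalemxAr.
  by congr (_%:~R *: _); ring.
- have [jk|jk] := eqVneq (j + 1 - k + 0) (i + i); last first.
    by rewrite (gin_off GV jk) mulmx0 [X in _ = X *m _]gin_off ?mul0mx //; lia.
  have -> : ((j + 1 - k) %/ 2)%Z = i by rewrite (_ : j + 1 - k = i * 2) ?mulzK //; lia.
  rewrite !mulmxA -[in RHS]mulmxA gin_goutK //; first by lia.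
  have w : xi i *m hB2 x i = hB2 x i *m xi i - hB2 x i.
    by rewrite -{3}w2 opprB addrC subrK.
  rewrite mulmxA w mulmxBl -mulmxA gin_eigen -scalemxAr -[X in _ - X = _]scale1r -scalerBl.
  by rewrite -(intrB _ _ 1); congr (_%:~R *: _); ring.
- have [jk|jk] := eqVneq (j - k + 1) (i + i); last first.
    by rewrite (gin_off GW jk) mulmx0 [X in _ = X *m _]gin_off ?mul0mx //; lia.
  have -> : ((j - k + 1) %/ 2)%Z = i by rewrite (_ : j - k + 1 = i * 2) ?mulzK //; lia.
  rewrite !mulmxA -[in RHS]mulmxA gin_goutK //; first by lia.
  by rewrite mulmxA wa -mulmxA gin_eigen -scalemxAr.
- have [jk|jk] := eqVneq (j - k + 0) (i + i); last first.
    by rewrite (gin_off GV jk) mulmx0 [X in _ = X *m _]gin_off ?mul0mx //; lia.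
  have -> : ((j - k) %/ 2)%Z = i by rewrite (_ : j - k = i * 2) ?mulzK //; lia.
  rewrite !mulmxA -[in RHS]mulmxA gin_goutK //; first by lia.
  have w : s (i + 1) *m hb x i = hb x i *m xi i - hb x i.
    by rewrite wb mulmxDl mul1mx addrK.
  rewrite mulmxA w mulmxBl -mulmxA gin_eigen -scalemxAr -[X in _ - X = _]scale1r -scalerBl.
  by rewrite -(intrB _ _ 1); congr (_%:~R *: _); ring.
Qed.

Lemma intertwines_moment x y : intertwines x y ->
  (forall i, handsaw_moment x i = 0) <-> (forall j k, quiverA_moment y j k = 0).
Proof.
move=> X.
have E i j k : handsaw_moment x i *m gin GV i (j + 1) k
    = gin GV (i + 1) (j + 1) (k - 1 - 1) *m quiverA_moment y j k.
  rewrite /handsaw_moment /quiverA_moment mulmxDl mulmxBl mulmxDr mulmxBr -!mulmxA.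
  by rewrite (intB1 X) (intB2 X) (intb X) !mulmxA (intB1 X) (intB2 X) (inta X).
split=> [m0 j k|m0 i]; last first.
  by apply: (gin_epiS (G := GV)) => j k; rewrite E m0 mulmx0 mul0mx.
have [|d0] := parity_dim GV (j + 1) k; last exact: mx_col0.
move: (((j + 1 - k + 0) %/ 2)%Z) => i jk.
have GK := @ginK _ _ _ _ _ GV (i + 1) (j + 1) (k - 1 - 1).
by rewrite -[LHS]mul1mx -GK -?mulmxA -?E ?m0 ?mul0mx ?mulmx0 //; lia.
Qed.

(** Here and in the next two lemmas the intertwining equations pass to the projections, the form
    needed for subspaces defined by the components of a vector. *)
Lemma outB1 x y (i j k : int) : intertwines x y ->
  gout GV (i + 1) (j + 1) (k - 1) *m hB1 x i = qB1 y j k *m gout GV i j k.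
Proof.
move=> X; apply: (gin_epi (G := GV)) => j' k'; rewrite -!mulmxA (intB1 X).
have [[<- <-]|ne] := eqVneq (j, k) (j', k'); last first.
  rewrite [LHS]mulmxA !gout_gin_neq ?mul0mx ?mulmx0 //.
  by move: ne; rewrite !xpair_eqE !(inj_eq (addIr _)).
have [jk|jk] := eqVneq (j - k + 0) (i + i).
  by rewrite [LHS]mulmxA !ginK ?mul1mx ?mulmx1 //; lia.
by rewrite !gin_off ?mulmx0 ?mul0mx ?mulmx0 //; lia.
Qed.

Lemma outB2 x y (i j k : int) : intertwines x y ->
  gout GV i j (k - 1) *m hB2 x i = qB2 y j k *m gout GV i (j + 1) k.
Proof.
move=> X; apply: (gin_epiS (G := GV)) => j' k'; rewrite -!mulmxA (intB2 X).
have [[<- <-]|ne] := eqVneq (j, k) (j', k'); last first.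
  rewrite [LHS]mulmxA !gout_gin_neq ?mul0mx ?mulmx0 //;
  by move: ne; rewrite !xpair_eqE !(inj_eq (addIr _)).
have [jk|jk] := eqVneq (j + 1 - k + 0) (i + i).
  by rewrite [LHS]mulmxA !ginK ?mul1mx ?mulmx1 //; lia.
by rewrite !gin_off ?mulmx0 ?mul0mx ?mulmx0 //; lia.
Qed.

Lemma outa x y (i j k : int) : intertwines x y ->
  gout GV i j (k - 1) *m ha x i = qa y j k *m gout GW i j k.
Proof.
move=> X; apply: (gin_epi (G := GW)) => j' k'; rewrite -!mulmxA (inta X).
have [[<- <-]|ne] := eqVneq (j, k) (j', k'); last first.
  rewrite [LHS]mulmxA !gout_gin_neq ?mul0mx ?mulmx0 //.
  by move: ne; rewrite !xpair_eqE !(inj_eq (addIr _)).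
have [jk|jk] := eqVneq (j - k + 1) (i + i).
  by rewrite [LHS]mulmxA !ginK ?mul1mx ?mulmx1 //; lia.
by rewrite !gin_off ?mulmx0 ?mul0mx ?mulmx0 //; lia.
Qed.

(** From left to right, a graded [S] is tested through the vectors with all components in [S]. From
    right to left, [S] need not be compatible with the weights; its homogeneous vectors form a
    graded subrepresentation, and once these are everything so is [S]. *)
Lemma intertwines_stable x y : intertwines x y ->
  handsaw_stable x <-> quiverA_stable y.
Proof.
move=> X; split=> st S S1 S2 Sa.
- have /dep_choice[S' S'P] : forall i, exists S' : {vspace 'cV[K]_(N i)},
      forall u, u \in S' <-> forall j k, gout GV i j k *m u \in S j k.
    move=> i; apply: vspace_of_linear_set => [j k|a u v Pu Pv j k].
      by rewrite mulmx0 mem0v.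
    by rewrite mulmxDr -scalemxAr memvD ?memvZ ?Pu ?Pv.
  have full i : S' i = fullv.
    apply: st i => i u.
    - move/S'P => Su; apply/S'P => j k.
      rewrite -(subrK 1 j) -(addrK 1 k) mulmxA (outB1 _ _ _ X) -mulmxA.
      exact: (S1 _ _ _ (Su _ _)).
    - move/S'P => Su; apply/S'P => j k.
      by rewrite -(addrK 1 k) mulmxA (outB2 _ _ _ X) -mulmxA; apply: (S2 _ _ _ (Su _ _)).
    - by apply/S'P => j k; rewrite -(addrK 1 k) mulmxA (outa _ _ _ X) -mulmxA.
  move=> j k; apply/eqP; rewrite eqEsubv subvf; apply/subvP => u _.
  have [|d0] := parity_dim GV j k; last by rewrite [u](mx_row0 _ 0) ?mem0v.
  move: ((j - k + 0) %/ 2)%Z => i jk.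
  rewrite -[u]mul1mx -(ginK GV jk) -mulmxA.
  suff /S'P : gin GV i j k *m u \in S' i by apply.
  by rewrite full memvf.
- have /dep_choice[S'' S''P] : forall p : int * int,
      exists S' : {vspace 'cV[K]_(DV p.1 p.2)},
      forall u, u \in S' <-> forall i, gin GV i p.1 p.2 *m u \in S i.
    move=> [j k]; apply: vspace_of_linear_set => [i|a u v Pu Pv i].
      by rewrite mulmx0 mem0v.
    by rewrite mulmxDr -scalemxAr memvD ?memvZ ?Pu ?Pv.
  pose S' j k := S'' (j, k).
  have S'P j k u : u \in S' j k <-> forall i, gin GV i j k *m u \in S i := S''P (j, k) u.
  have full j k : S' j k = fullv.
    apply: st j k => j k u.
    - move/S'P => Su; apply/S'P => i; rewrite -(subrK 1 i) mulmxA -(intB1 X) -mulmxA.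
      exact: (S1 _ _ (Su _)).
    - move/S'P => Su; apply/S'P => i; rewrite mulmxA -(intB2 X) -mulmxA.
      exact: (S2 _ _ (Su _)).
    - by apply/S'P => i; rewrite mulmxA -(inta X) -mulmxA.
  move=> i; apply/eqP; rewrite eqEsubv subvf; apply/subvP => u _.
  rewrite -[u]mul1mx -(gsum GV) mulmx_suml; apply: memv_suml => m _.
  rewrite -mulmxA; set w := _ *m u.
  suff /S'P : w \in S' (i + m) (m - i + 0) by apply.
  by rewrite full memvf.
Qed.

End Assembly.

(** * Orbits and equivariant frames *)

Lemma invmxM (R : comUnitRingType) n (A B : 'M[R]_n) :
  A \in unitmx -> B \in unitmx -> invmx (A *m B) = invmx B *m invmx A.
Proof.
move=> uA uB; have uAB : A *m B \in unitmx by rewrite unitmx_mul uA.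
by apply: (can_inj (mulKmx uAB)); rewrite mulmxV // mulmxA mulmxK // mulmxV.
Qed.

Section Actions.
Variables (K : closedFieldType) (N NW : int -> nat).
Implicit Types (x : handsaw K N NW) (g h : forall i, 'M[K]_(N i)).

Lemma handsaw_act1 x : handsaw_act (fun=> 1%:M) x = x.
Proof. by apply: handsaw_eq => i /=; rewrite ?invmx1 ?mul1mx ?mulmx1. Qed.

Lemma handsaw_actM g h x : (forall i, g i \in unitmx) -> (forall i, h i \in unitmx) ->
  handsaw_act g (handsaw_act h x) = handsaw_act (fun i => g i *m h i) x.
Proof. by move=> ug uh; apply: handsaw_eq => i /=; rewrite ?invmxM ?mulmxA. Qed.

Lemma handsaw_actK g x : (forall i, g i \in unitmx) ->
  handsaw_act (fun i => invmx (g i)) (handsaw_act g x) = x.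
Proof.
move=> ug; rewrite handsaw_actM // => [|i]; last by rewrite unitmx_inv.
rewrite -[RHS]handsaw_act1; congr handsaw_act.
by apply: functional_extensionality_dep => i; rewrite mulVmx.
Qed.

Lemma handsaw_moment_act g x i : (forall i, g i \in unitmx) ->
  handsaw_moment (handsaw_act g x) i = g (i + 1) *m handsaw_moment x i *m invmx (g i).
Proof.
move=> ug; rewrite /handsaw_moment /= !mulmxDr !mulmxDl mulmxN mulNmx.
by rewrite !mulmxA !mulmxKV.
Qed.

Lemma handsaw_stable_act g x : (forall i, g i \in unitmx) ->
  handsaw_stable x -> handsaw_stable (handsaw_act g x).
Proof.
move=> ug st S S1 S2 Sa.
have /dep_choice[S' S'P] : forall i, exists S' : {vspace 'cV[K]_(N i)},
    forall u, u \in S' <-> g i *m u \in S i.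
  move=> i; apply: vspace_of_linear_set => [|a u v Pu Pv].
    by rewrite mulmx0 mem0v.
  by rewrite mulmxDr -scalemxAr memvD ?memvZ ?Pu ?Pv.
have full i : S' i = fullv.
  apply: st i => i u.
  - by move/S'P/S1 => /=; rewrite !mulmxA mulmxKV // => Su; apply/S'P; rewrite mulmxA.
  - by move/S'P/S2 => /=; rewrite !mulmxA mulmxKV // => Su; apply/S'P; rewrite mulmxA.
  - by apply/S'P; rewrite mulmxA; apply: Sa.
move=> i; apply/eqP; rewrite eqEsubv subvf; apply/subvP => u _.
suff /S'P : invmx (g i) *m u \in S' i by rewrite mulmxA mulmxV // mul1mx.
by rewrite full memvf.
Qed.

Variable s : forall i, 'M[K]_(NW i).

Lemma weight_operator_act g x xi : (forall i, g i \in unitmx) ->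
  weight_operator s x xi ->
  weight_operator s (handsaw_act g x) (fun i => g i *m xi i *m invmx (g i)).
Proof.
move=> ug [w1 w2 wa wb]; split=> i /=; rewrite !mulmxA ?mulmxKV //.
- have /eqP := w1 i; rewrite subr_eq0 => /eqP w.
  by rewrite -(mulmxA (g (i + 1))) w mulmxA subrr.
- by rewrite -[in RHS]w2 mulmxBr mulmxBl !mulmxA.
- by rewrite -mulmxA wa mulmxA.
- by rewrite wb.
Qed.

(* The difference of two weight operators vanishes on a subrepresentation
   containing the image of [a]. *)
Lemma weight_operator_unique x xi xi' : handsaw_stable x ->
  weight_operator s x xi -> weight_operator s x xi' -> forall i, xi i = xi' i.
Proof.
move=> st [w1 w2 wa wb] [w1' w2' wa' wb'].
have /dep_choice[S SP] : forall i, exists S : {vspace 'cV[K]_(N i)},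
    forall u, u \in S <-> xi i *m u = xi' i *m u.
  move=> i; apply: vspace_of_linear_set => [|a u v Pu Pv]; first by rewrite !mulmx0.
  by rewrite !mulmxDr -!scalemxAr Pu Pv.
have full i : S i = fullv.
  apply: st i => i u.
  - move/SP => Su; apply/SP; rewrite !mulmxA.
    have /eqP := w1 i; rewrite subr_eq0 => /eqP <-.
    have /eqP := w1' i; rewrite subr_eq0 => /eqP <-.
    by rewrite -!mulmxA Su.
  - have w (t : 'M_(N i)) : hB2 x i *m t - t *m hB2 x i = hB2 x i ->
        t *m hB2 x i = hB2 x i *m t - hB2 x i.
      by move=> /(canRL (subrK _)) ->; rewrite addrAC subrr add0r.
    move/SP => Su; apply/SP; rewrite !mulmxA (w _ (w2 i)) (w _ (w2' i)) !mulmxBl.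
    by rewrite -!mulmxA Su.
  - by apply/SP; rewrite !mulmxA wa wa'.
move=> i; rewrite -[xi i]mulmx1 -[xi' i]mulmx1; apply/matrixP => p q.
have /SP : col q 1%:M \in S i by rewrite full memvf.
by rewrite !colE !mulmxA -!colE => /matrixP/(_ p 0); rewrite !mxE.
Qed.

End Actions.

Section QuiverActions.
Variables (K : closedFieldType) (DV DW : int -> int -> nat).
Implicit Types (y : quiverA K DV DW) (g h : forall j k, 'M[K]_(DV j k)).

Lemma quiverA_act1 y : quiverA_act (fun _ _ => 1%:M) y = y.
Proof. by apply: quiverA_eq => j k /=; rewrite ?invmx1 ?mul1mx ?mulmx1. Qed.

Lemma quiverA_actM g h y : (forall j k, g j k \in unitmx) ->
  (forall j k, h j k \in unitmx) ->
  quiverA_act g (quiverA_act h y) = quiverA_act (fun j k => g j k *m h j k) y.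
Proof. by move=> ug uh; apply: quiverA_eq => j k /=; rewrite ?invmxM ?mulmxA. Qed.

Lemma quiverA_actK g y : (forall j k, g j k \in unitmx) ->
  quiverA_act (fun j k => invmx (g j k)) (quiverA_act g y) = y.
Proof.
move=> ug; rewrite quiverA_actM // => [|j k]; last by rewrite unitmx_inv.
rewrite -[RHS]quiverA_act1; congr quiverA_act.
by do 2!apply: functional_extensionality_dep => ?; rewrite mulVmx.
Qed.

End QuiverActions.

Section Orbits.
Variables (K : closedFieldType) (N NW : int -> nat) (DV DW : int -> int -> nat).
Variables (xi : forall i, 'M[K]_(N i)) (s : forall i, 'M[K]_(NW i)).
Variables (GV : grading xi DV 0) (GW : grading s DW 1).
Hypothesis intr_inj : injective (fun m : int => m%:~R : K).
Implicit Types (x : handsaw K N NW) (y : quiverA K DV DW).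

Lemma intertwines_act x y h : (forall j k, h j k \in unitmx) ->
  intertwines GV GW x y ->
  intertwines GV GW (handsaw_act (gact GV h) x) (quiverA_act h y).
Proof.
move=> uh X; split=> i j k /=.
- rewrite -mulmxA invmx_gact_gin // mulmxA -(mulmxA (gact _ _ _)) (intB1 X).
  by rewrite !mulmxA gact_gin.
- rewrite -mulmxA invmx_gact_gin // mulmxA -(mulmxA (gact _ _ _)) (intB2 X).
  by rewrite !mulmxA gact_gin.
- by rewrite -mulmxA (inta X) !mulmxA gact_gin.
- by rewrite -mulmxA invmx_gact_gin // mulmxA (intb X) !mulmxA.
Qed.

(* An element carrying one homogeneous point to another commutes with the
   grading, the weight operator of a stable point being unique. *)
Lemma intertwines_orbit x y x' y' g : (forall i, g i \in unitmx) ->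
  handsaw_stable x -> x' = handsaw_act g x ->
  intertwines GV GW x y -> intertwines GV GW x' y' ->
  exists2 h, (forall j k, h j k \in unitmx) & y' = quiverA_act h y.
Proof.
move=> ug st x'E X X'.
have gxi i : g i *m xi i = xi i *m g i.
  have := weight_operator_unique (handsaw_stable_act ug st)
    (weight_operator_act ug (intertwines_weight X)) _ i.
  by rewrite -x'E => /(_ _ (intertwines_weight X')) E; rewrite -{2}E mulmxKV.
have gVxi i : invmx (g i) *m xi i = xi i *m invmx (g i).
  by rewrite -[xi i in LHS](mulmxK (ug i)) -gxi !mulmxA mulVmx // mul1mx.
(* An operator commuting with [xi] preserves its eigenspaces, so it is determined by its diagonal
   blocks. *)
have comm_gin (t : forall i, 'M_(N i)) i j k : (forall i, t i *m xi i = xi i *m t i) ->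
    gin GV i j k *m (gout GV i j k *m t i *m gin GV i j k) = t i *m gin GV i j k.
  move=> txi; have [jk|jk] := eqVneq (j - k + 0) (i + i); last first.
    by rewrite !(gin_off GV jk) !mulmx0.
  rewrite -mulmxA mulmxA gin_goutK // mulmxA -txi -mulmxA gin_eigen.
  by rewrite -scalemxAr.
pose c (t : forall i, 'M[K]_(N i)) j k : 'M[K]_(DV j k) :=
  let i := ((j - k + 0) %/ 2)%Z in gout GV i j k *m t i *m gin GV i j k.
have cg t i j k : (forall i, t i *m xi i = xi i *m t i) ->
    gin GV i j k *m c t j k = t i *m gin GV i j k.
  move=> txi; have [jk|jk] := eqVneq (j - k + 0) (i + i); last first.
    by rewrite (gin_off GV jk) mulmx0 mul0mx.
  have jkE : ((j - k + 0) %/ 2)%Z = i by rewrite (_ : j - k + 0 = i * 2) ?mulzK //; lia.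
  by rewrite /c jkE comm_gin.
have uc j k : c g j k \in unitmx.
  suff /mulmx1_unit[] : c g j k *m c (fun i => invmx (g i)) j k = 1%:M by [].
  have [jk|d0] := parity_dim GV j k; last exact: mx_col0.
  rewrite -[LHS]mul1mx -(ginK GV jk) -mulmxA [X in _ *m X]mulmxA cg // -mulmxA cg //.
  by rewrite /= (mulmxA (g _)) mulmxV // mul1mx.
exists (c g) => //; rewrite -(extract_intertwines X'); apply: extract_intertwines.
have -> : x' = handsaw_act (gact GV (c g)) x; last exact: intertwines_act.
rewrite x'E; congr handsaw_act; apply: functional_extensionality_dep => i.
by apply: (gin_epi (G := GV)) => j k; rewrite gact_gin cg.
Qed.

(** Both gradings have components of the same sizes [DV], so each component of one can be carried to
    the same component of the other; eigenvalues match because they depend on the indices only. *)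
Lemma grading_conj (xi' : forall i, 'M[K]_(N i)) (G' : grading xi' DV 0) :
  exists2 g, (forall i, g i \in unitmx) &
    forall i, g i *m xi' i *m invmx (g i) = xi i.
Proof.
pose g (e1 e2 : forall i, 'M[K]_(N i)) (G1 : grading e1 DV 0) (G2 : grading e2 DV 0) i :=
  \sum_(m <- gsupp G1) gin G2 i (i + m) (m - i + 0) *m gout G1 i (i + m) (m - i + 0).
have gP e1 e2 (G1 : grading e1 DV 0) (G2 : grading e2 DV 0) i j k :
    g _ _ G1 G2 i *m gin G1 i j k = gin G2 i j k.
  have [jk|jk] := eqVneq (j - k + 0) (i + i); last by rewrite !gin_off // mulmx0.
  have := @glue_gin _ _ _ _ _ G1 i _ (fun m => i + m)
    (fun m => gin G2 i (i + m) (m - i + 0)) (j - i) (fun=> erefl).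
  have -> : i + (j - i) = j by ring.
  by have -> : j - i - i + 0 = k by lia.
have ug i : g _ _ G' GV i \in unitmx.
  suff /mulmx1_unit[] : g _ _ G' GV i *m g _ _ GV G' i = 1%:M by [].
  by apply: (gin_epi (G := GV)) => j k; rewrite -mulmxA !gP mul1mx.
exists (g _ _ G' GV) => // i; rewrite -[RHS](mulmxK (ug i)); congr (_ *m _).
apply: (gin_epi (G := G')) => j k.
by rewrite -!mulmxA gin_eigen -scalemxAr !gP gin_eigen.
Qed.

End Orbits.

(** * Covariants and equivariant frames *)

Section Frame.
Variables (K : closedFieldType) (N NW : int -> nat) (DV DW : int -> int -> nat).
Variables (xi : forall i, 'M[K]_(N i)) (s : forall i, 'M[K]_(NW i)).
Variables (GV : grading xi DV 0) (GW : grading s DW 1).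
Hypothesis intr_inj : injective (fun m : int => m%:~R : K).
Local Notation coord := (@handsaw_coord K N NW).

Lemma regular_hB1 i : regular_mx coord setT (fun x => hB1 x i).
Proof. by move=> p q; apply/regular_poly/polyfun_coord; constructor 1; exists i, p, q. Qed.

Lemma regular_hB2 i : regular_mx coord setT (fun x => hB2 x i).
Proof. by move=> p q; apply/regular_poly/polyfun_coord; constructor 2; exists i, p, q. Qed.

Lemma regular_ha i : regular_mx coord setT (fun x => ha x i).
Proof. by move=> p q; apply/regular_poly/polyfun_coord; constructor 3; exists i, p, q. Qed.

Lemma regular_hb i : regular_mx coord setT (fun x => hb x i).
Proof. by move=> p q; apply/regular_poly/polyfun_coord; constructor 4; exists i, p, q. Qed.

(** The weight is imposed at every point and for every weight operator there, not just at a base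
    point; this keeps the frame homogeneous at neighbouring fixed points. *)
Record covariant i (a : K) (c : handsaw K N NW -> 'cV[K]_(N i)) : Prop := Covariant {
  cov_regular : regular_mx coord setT c;
  cov_act : forall g x, (forall i, g i \in unitmx) ->
    c (handsaw_act g x) = g i *m c x;
  cov_weight : forall x z, weight_operator s x z -> z i *m c x = a *: c x
}.

Arguments covariant i a c : clear implicits.

Lemma covariantB1 i a c : covariant i a c ->
  covariant (i + 1) a (fun x => hB1 x i *m c x).
Proof.
case=> r e w; split=> [|g x ug|x z wx].
- by apply: regular_mxM; [apply: regular_hB1|apply: r].
- by rewrite e // /= !mulmxA mulmxKV.
- have [w1 _ _ _] := wx; have /eqP := w1 i; rewrite subr_eq0 => /eqP w1i.
  by rewrite mulmxA -w1i -mulmxA w // scalemxAr.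
Qed.

Lemma covariantB2 i a c : covariant i a c ->
  covariant i (a - 1) (fun x => hB2 x i *m c x).
Proof.
case=> r e w; split=> [|g x ug|x z wx].
- by apply: regular_mxM; [apply: regular_hB2|apply: r].
- by rewrite e // /= !mulmxA mulmxKV.
- have [_ w2 _ _] := wx.
  have -> : z i *m (hB2 x i *m c x) = hB2 x i *m z i *m c x - hB2 x i *m c x.
    by rewrite -[X in _ - X *m _]w2 mulmxBl opprB addrC subrK mulmxA.
  by rewrite -mulmxA w // -scalemxAr scalerBl scale1r.
Qed.

Lemma covarianta i a u : s i *m u = a *: u -> covariant i a (fun x => ha x i *m u).
Proof.
move=> su; split=> [|g x ug|x z wx].
- by apply: regular_mxM; [apply: regular_ha|apply: regular_mx_cst].
- by rewrite /= mulmxA.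
- by have [_ _ wa _] := wx; rewrite mulmxA wa -mulmxA su scalemxAr.
Qed.

Lemma covariant_lin i a b c c' : covariant i a c -> covariant i a c' ->
  covariant i a (fun x => b *: c x + c' x).
Proof.
case=> r e w [r' e' w']; split=> [|g x ug|x z wx].
- apply: regular_mxD => // p q; under eq_fun do rewrite mxE.
  by apply: regularM; [exact: regular_cst|exact: r].
- by rewrite e // e' // mulmxDr scalemxAr.
- by rewrite mulmxDr -scalemxAr w // w' // scalerDr scalerA mulrC -scalerA.
Qed.

Lemma covariant0 i a : covariant i a (fun=> 0).
Proof.
split=> [|g x ug|x z wx]; first exact: regular_mx_cst.
- by rewrite mulmx0.
- by rewrite mulmx0 scaler0.
Qed.

(* The homogeneous covariants generate a subrepresentation, so by stability they
   take every homogeneous value at [x0]. *)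
Lemma covariant_value x0 : handsaw_stable x0 -> weight_operator s x0 xi ->
  forall i j k u, exists2 c, covariant i (j - i)%:~R c &
    c x0 = gin GV i j k *m gout GV i j k *m u.
Proof.
move=> st /(weight_intertwines GV GW intr_inj).
move: (extract GV GW x0) => y X.
(* The condition is put on each homogeneous component separately, since a sum of covariants of
   different weights is not a covariant. *)
have /dep_choice[S SP] : forall i, exists S : {vspace 'cV[K]_(N i)},
    forall u, u \in S <-> forall j k, exists2 c, covariant i (j - i)%:~R c &
      c x0 = gin GV i j k *m gout GV i j k *m u.
  move=> i; apply: vspace_of_linear_set => [j k|a u v Pu Pv j k].
    by exists (fun=> 0); [exact: covariant0|rewrite mulmx0].
  have [c cc cE] := Pu j k; have [c' cc' cE'] := Pv j k.
  exists (fun x => a *: c x + c' x); first exact: covariant_lin.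
  by rewrite cE cE' mulmxDr scalemxAr.
suff full i : S i = fullv.
  by move=> i j k u; have := memvf u; rewrite -(full i) => /SP; apply.
apply: st i => i u.
- move/SP => Su; apply/SP => j k; rewrite -(subrK 1 j) -(addrK 1 k).
  have [c cc cE] := Su (j - 1) (k + 1).
  (* B1 sends the component (j - 1, k + 1) of V_i to (j, k) in V_(i+1); the weight is j - 1 - i for
     both. *)
  exists (fun x => hB1 x i *m c x).
    rewrite (_ : j - 1 + 1 - (i + 1) = j - 1 - i); first exact: covariantB1.
    by ring.
  rewrite cE !mulmxA (intB1 X) -!mulmxA; congr (_ *m _).
  by rewrite !mulmxA (outB1 _ _ _ X).
- move/SP => Su; apply/SP => j k; rewrite -(addrK 1 k).
  have [c cc cE] := Su (j + 1) (k + 1).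
  exists (fun x => hB2 x i *m c x).
    have := covariantB2 cc; rewrite -(intrB _ _ 1).
    by rewrite (_ : j + 1 - i - 1 = j - i); last ring.
  rewrite cE !mulmxA (intB2 X) -!mulmxA; congr (_ *m _).
  by rewrite !mulmxA (outB2 _ _ _ X).
- apply/SP => j k; rewrite -(addrK 1 k).
  exists (fun x => ha x i *m (gin GW i j (k + 1) *m gout GW i j (k + 1) *m u)).
    by apply: covarianta; rewrite !mulmxA gin_eigen -!scalemxAl.
  rewrite !mulmxA (inta X) -!mulmxA; congr (_ *m _).
  by rewrite !mulmxA (outa _ _ _ X).
Qed.

Lemma covariant_frame x0 : handsaw_stable x0 -> weight_operator s x0 xi ->
  exists M : forall i, handsaw K N NW -> 'M[K]_(N i),
    [/\ forall i, regular_mx coord setT (M i),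
        forall i g x, (forall i, g i \in unitmx) ->
          M i (handsaw_act g x) = g i *m M i x,
        forall i x z, weight_operator s x z -> z i *m M i x = M i x *m xi i &
        forall i, M i x0 = 1%:M].
Proof.
move=> st wx0; have val := covariant_value st wx0.
suff /dep_choice[M MP] : forall i, exists M : handsaw K N NW -> 'M[K]_(N i),
    [/\ regular_mx coord setT M,
        forall g x, (forall i, g i \in unitmx) ->
          M (handsaw_act g x) = g i *m M x,
        forall x z, weight_operator s x z -> z i *m M x = M x *m xi i &
        M x0 = 1%:M].
  by exists M; split=> i *; have [? ? ? ?] := MP i; auto.
move=> i.
pose pr m := gin GV i (i + m) (m - i + 0) *m gout GV i (i + m) (m - i + 0).
have /dep_choice[c cP] : forall mp : int * 'I_(N i), exists c,
    covariant i (i + mp.1 - i)%:~R c /\ c x0 = pr mp.1 *m delta_mx mp.2 0.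
  by move=> [m p]; have [c cc cE] := val i (i + m) (m - i + 0) (delta_mx p 0); exists c.
have prxi m : pr m *m xi i = (i + m - i)%:~R *: pr m.
  by rewrite /pr -mulmxA gout_eigen scalemxAr.
have pr1 : \sum_(m <- gsupp GV) pr m = 1%:M by exact: gsum.
have prE m : pr m *m pr m = pr m.
  by rewrite /pr mulmxA -(mulmxA (gin _ _ _ _)) ginK ?mulmx1 //; ring.
clearbody pr.
(* The right factor [pr m] feeds the covariants of weight m only with vectors of weight m, so the
   frame carries [xi] to the weight operator of [x]. At [x0] the inner sum is [pr m *m pr m], and
   the total is the identity. *)
exists (fun x => \sum_(m <- gsupp GV) \sum_p c (m, p) x *m (delta_mx 0 p *m pr m)).
split.
- apply: (@regular_mx_sum _ _ _ _ _ _ _ _ _ (fun m x =>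
    \sum_p c (m, p) x *m (delta_mx 0 p *m pr m))) => m.
  apply: (@regular_mx_sum _ _ _ _ _ _ _ _ _ (fun p x =>
    c (m, p) x *m (delta_mx 0 p *m pr m))) => p.
  by apply: regular_mxM; [apply: (cov_regular (cP (m, p)).1)|apply: regular_mx_cst].
- move=> g x ug; rewrite mulmx_sumr; apply: eq_bigr => m _.
  rewrite mulmx_sumr; apply: eq_bigr => p _.
  by rewrite (cov_act (cP (m, p)).1) // [RHS]mulmxA.
- move=> x z wx; rewrite mulmx_sumr mulmx_suml; apply: eq_bigr => m _.
  rewrite mulmx_sumr mulmx_suml; apply: eq_bigr => p _.
  rewrite mulmxA (cov_weight (cP (m, p)).1) // -!mulmxA prxi.
  by rewrite -!scalemxAr scalemxAl.
- rewrite -pr1; apply: eq_bigr => m _.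
  rewrite -[RHS]prE -[X in _ = X *m _]mulmx1 mx1_sum_delta mulmx_sumr mulmx_suml.
  apply: eq_bigr => p _; rewrite (cP (m, p)).2 -!mulmxA; congr (_ *m _).
  by rewrite mulmxA mul_delta_mx.
Qed.

End Frame.

(** * The isomorphism *)

Section Isomorphism.
Variables (K : closedFieldType) (v : int -> int -> nat) (NW : int -> nat).
Variables (DV DW : int -> int -> nat).
Local Notation N := (total_dim v).
Variables (xi : forall i, 'M[K]_(N i)) (s : forall i, 'M[K]_(NW i)).
Variables (GV : grading xi DV 0) (GW : grading s DW 1) (r : seq int).
Hypothesis intr_inj : injective (fun m : int => m%:~R : K).
Hypothesis xi_dims : semisimple_with_dims xi v.
Hypothesis dims_grading :
  forall z : (forall i, 'M[K]_(N i)), semisimple_with_dims z v ->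
    inhabited (grading z DV 0).
Hypothesis N_supp : forall i, i \notin r -> N i = 0%N.

Local Notation AX := (affine_fspace (@handsaw_coord K N NW)).
Local Notation AY := (affine_fspace (@quiverA_coord K DV DW)).
Local Notation X := (handsaw_space K N NW).
Local Notation Y := (quiverA_space K DV DW).
Local Notation Q := (handsaw_variety K N NW).
Local Notation Z := (graded_handsaw_variety v s).
Local Notation QY := (quiverA_variety K DV DW).

Definition handsaw_equiv (x x' : X) := exists2 g : forall i, 'M[K]_(N i),
  (forall i, g i \in unitmx) & sval x' = handsaw_act g (sval x).

Definition quiverA_equiv (y y' : Y) := exists2 h : forall j k, 'M[K]_(DV j k),
  (forall j k, h j k \in unitmx) & sval y' = quiverA_act h (sval y).

Local Notation clX := (orbit_class handsaw_equiv : X -> Q).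
Local Notation clY := (orbit_class quiverA_equiv : Y -> QY).

Lemma clX_eq x x' : clX x = clX x' <-> handsaw_equiv x x'.
Proof.
apply: orbit_class_eq => [{x x'}x|{x x'}x x' [g ug E]|x1 x2 x3 [g ug E] [h uh E']].
- exists (fun=> 1%:M) => [i|]; first exact: unitmx1.
  by rewrite handsaw_act1.
- exists (fun i => invmx (g i)) => [i|]; first by rewrite unitmx_inv.
  by rewrite E handsaw_actK.
- exists (fun i => h i *m g i) => [i|]; first by rewrite unitmx_mul uh ug.
  by rewrite E' E handsaw_actM.
Qed.

Lemma clY_eq y y' : clY y = clY y' <-> quiverA_equiv y y'.
Proof.
apply: orbit_class_eq => [{y y'}y|{y y'}y y' [g ug E]|y1 y2 y3 [g ug E] [h uh E']].
- exists (fun _ _ => 1%:M) => [j k|]; first exact: unitmx1.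
  by rewrite quiverA_act1.
- exists (fun j k => invmx (g j k)) => [j k|]; first by rewrite unitmx_inv.
  by rewrite E quiverA_actK.
- exists (fun j k => h j k *m g j k) => [j k|]; first by rewrite unitmx_mul uh ug.
  by rewrite E' E quiverA_actM.
Qed.

Lemma ringedX : ringed_axioms X.
Proof. exact/sub_ringed/affine_ringed. Qed.

Lemma ringedQ : ringed_axioms Q.
Proof. exact/quot_ringed/ringedX. Qed.

Lemma ringedY : ringed_axioms Y.
Proof. exact/sub_ringed/affine_ringed. Qed.

Lemma ringedZ : ringed_axioms Z.
Proof. exact/sub_ringed/ringedQ. Qed.

Lemma ringedQY : ringed_axioms QY.
Proof. exact/quot_ringed/ringedY. Qed.

Lemma handsaw_point x : (forall i, handsaw_moment x i = 0) -> handsaw_stable x ->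
  exists x' : X, sval x' = x.
Proof.
move=> m0 st; exists (@exist _ (fun x => (forall i, handsaw_moment x i = 0) /\
  handsaw_stable x) x (conj m0 st)).
by [].
Qed.

Lemma quiverA_point y : (forall j k, quiverA_moment y j k = 0) -> quiverA_stable y ->
  exists y' : Y, sval y' = y.
Proof.
move=> m0 st; exists (@exist _ (fun y => (forall j k, quiverA_moment y j k = 0) /\
  quiverA_stable y) y (conj m0 st)).
by [].
Qed.

Lemma handsaw_space_act (x : X) g : (forall i, g i \in unitmx) ->
  exists2 x' : X, sval x' = handsaw_act g (sval x) & clX x' = clX x.
Proof.
move=> ug; have [m0 st] := svalP x.
have [||x' x'E] := @handsaw_point (handsaw_act g (sval x)).
- by move=> i; rewrite handsaw_moment_act // m0 mulmx0 mul0mx.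
- exact: handsaw_stable_act.
by exists x' => //; apply/esym/clX_eq; exists g.
Qed.

(** The isomorphism is handled as a relation, total and single-valued in both directions. The two
    maps are chosen inside it, and their regularity is proved for any such choice. *)
Definition matched (z : Z) (c : QY) := exists (x : X) (y : Y),
  [/\ sval z = clX x, c = clY y & intertwines GV GW (sval x) (sval y)].

(** The weight operator of a representative has eigenspace dimensions [v], hence is conjugate to
    [xi]; moving the point by the conjugating element makes [xi] itself its weight operator. *)
Lemma graded_rep (z : Z) :
  exists2 x : X, sval z = clX x & weight_operator s (sval x) xi.
Proof.
case: z => c [_ [x cx [e wx de]]] /=.
have [x1 cE] := orbit_classP c.
have [G'] := dims_grading de; have [g ug gE] := grading_conj GV G'.
have [x' x'E x'x] := handsaw_space_act x ug.
exists x'; first by rewrite x'x cE; apply/clX_eq; move: cx; rewrite cE.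
rewrite x'E; have := weight_operator_act ug wx.
by rewrite (_ : (fun i => g i *m e i *m invmx (g i)) = xi) //;
  apply: functional_extensionality_dep.
Qed.

Lemma graded_class (x : X) : weight_operator s (sval x) xi ->
  exists z : Z, sval z = clX x.
Proof.
move=> wx; have xx : sval (clX x) x by apply/clX_eq.
have Zx : (zero_locus s `&` [set c | exists2 x, sval c x &
    exists2 xi, weight_operator s (sval x) xi & semisimple_with_dims xi v]) (clX x).
  split; exists x => //; last by exists xi.
  (* The sign comes from the component a, where the tangent vectors are [- a s] and [eta a] while
     [xi a = a s]. *)
  exists (fun i => - xi i); have [w1 w2 wa wb] := wx.
  apply: handsaw_eq => i /=.
  - by rewrite mulNmx mulmxN opprK [RHS]addrC w1.
  - by rewrite mulNmx mulmxN opprK [RHS]addrC w2.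
  - by rewrite mulNmx wa.
  - by rewrite mulmxN opprK wb mulmxDl mul1mx [RHS]addrC.
by exists (@exist Q _ _ Zx).
Qed.

Lemma intertwines_quiverA (x : X) : weight_operator s (sval x) xi ->
  exists y : Y, intertwines GV GW (sval x) (sval y).
Proof.
move=> /(weight_intertwines GV GW intr_inj) I; have [m0 st] := svalP x.
have [y yE] := quiverA_point ((intertwines_moment I).1 m0) ((intertwines_stable I).1 st).
by exists y; rewrite yE.
Qed.

Lemma intertwines_handsaw (y : Y) :
  exists x : X, sval x = assemble GV GW (sval y).
Proof.
have [m0 st] := svalP y; have I := assembleP GV GW (sval y).
exact: handsaw_point ((intertwines_moment I).2 m0) ((intertwines_stable I).2 st).
Qed.

Lemma matched_total z : exists c, matched z c.
Proof.
have [x zx /intertwines_quiverA[y xy]] := graded_rep z.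
by exists (clY y), x, y.
Qed.

Lemma matched_assemble (y : Y) (x : X) : sval x = assemble GV GW (sval y) ->
  exists2 z, matched z (clY y) & sval z = clX x.
Proof.
move=> xE; have I : intertwines GV GW (sval x) (sval y) by rewrite xE; apply: assembleP.
have [z zE] := graded_class (intertwines_weight I).
by exists z => //; exists x, y.
Qed.

Lemma matched_surj c : exists z, matched z c.
Proof.
have [y ->] := orbit_classP c; have [x /matched_assemble[z zc _]] := intertwines_handsaw y.
by exists z.
Qed.

Lemma matched_fun z c c' : matched z c -> matched z c' -> c = c'.
Proof.
move=> [x [y [zx -> I]]] [x' [y' [zx' -> I']]].
have /clX_eq[g ug x'E] : clX x = clX x' by rewrite -zx.
have [_ st] := svalP x.
by apply/clY_eq; apply: (intertwines_orbit intr_inj ug st x'E I I').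
Qed.

Lemma matched_inj z z' c : matched z c -> matched z' c -> z = z'.
Proof.
move=> [x [y [zx cy I]]] [x' [y' [zx' cy' I']]].
have /clY_eq[h uh y'E] : clY y = clY y' by rewrite -cy.
apply: eq_sig_hprop => [? ? ?|]; first exact: Prop_irrelevance.
rewrite /= zx zx'; apply/clX_eq; exists (gact GV h) => [i|]; first exact: gact_unit.
by apply: (intertwines_injl I'); rewrite y'E; apply: intertwines_act.
Qed.

Lemma morphism_assemble : morphism (assemble GV GW : AY -> AX).
Proof.
apply/morphism_onT/morphism_on_affine; first exact/zopenT/affine_ringed.
have r1 j k : regular_mx (@quiverA_coord K DV DW) setT (fun y => qB1 y j k).
  by move=> p q; apply/regular_poly/polyfun_coord; constructor 1; exists j, k, p, q.
have r2 j k : regular_mx (@quiverA_coord K DV DW) setT (fun y => qB2 y j k).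
  by move=> p q; apply/regular_poly/polyfun_coord; constructor 2; exists j, k, p, q.
have ra j k : regular_mx (@quiverA_coord K DV DW) setT (fun y => qa y j k).
  by move=> p q; apply/regular_poly/polyfun_coord; constructor 3; exists j, k, p, q.
have rb j k : regular_mx (@quiverA_coord K DV DW) setT (fun y => qb y j k).
  by move=> p q; apply/regular_poly/polyfun_coord; constructor 4; exists j, k, p, q.
have sandwich a b d e (A : 'M[K]_(a, b)) (B : 'M[K]_(d, e)) f :
    regular_mx (@quiverA_coord K DV DW) setT f ->
    regular_mx (@quiverA_coord K DV DW) setT (fun y => A *m f y *m B).
  move=> rf; apply: regular_mxM; last exact: regular_mx_cst.
  by apply: regular_mxM; first exact: regular_mx_cst.
have rB1 i : regular_mx (@quiverA_coord K DV DW) setT (fun y => hB1 (assemble GV GW y) i).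
  by apply: regular_mx_sum => m; apply: sandwich.
have rB2 i : regular_mx (@quiverA_coord K DV DW) setT (fun y => hB2 (assemble GV GW y) i).
  by apply: regular_mx_sum => m; apply: sandwich.
have rha i : regular_mx (@quiverA_coord K DV DW) setT (fun y => ha (assemble GV GW y) i).
  by apply: regular_mx_sum => m; apply: sandwich.
have rhb i : regular_mx (@quiverA_coord K DV DW) setT (fun y => hb (assemble GV GW y) i).
  by apply: regular_mx_sum => m; apply: sandwich.
move=> c [] [i [p [q ->]]]; [exact: rB1|exact: rB2|exact: rha|exact: rhb].
Qed.

(** By [matched_inj], any such [g] lifts to representatives as [assemble], whose entries are
    polynomial. *)
Lemma morphism_matched_inv (g : QY -> Z) : (forall c, matched (g c) c) -> morphism g.
Proof.
move=> gP; apply: morphism_sub; first exact: ringedQY.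
apply: morphism_quot.
have /choice[a aE] := intertwines_handsaw.
have -> : (sval \o g) \o clY = clX \o a.
  apply/funext => y /=; have [z zy <-] := matched_assemble (aE y).
  by rewrite (matched_inj (gP _) zy).
apply: (morphism_comp (Y := X)); last exact: morphism_orbit_class.
apply: morphism_sub; first exact: ringedY.
rewrite (_ : sval \o a = assemble GV GW \o sval); last exact/funext.
apply: (morphism_comp (Y := AY)); first exact: morphism_sval.
exact: morphism_assemble.
Qed.

(** * Normalization by a frame *)

Section Normalization.
Variable M : forall i, handsaw K N NW -> 'M[K]_(N i).
Hypothesis M_regular : forall i, regular_mx (@handsaw_coord K N NW) setT (M i).
Hypothesis M_act : forall i g x, (forall i, g i \in unitmx) ->
  M i (handsaw_act g x) = g i *m M i x.
Hypothesis M_weight : forall i x z, weight_operator s x z ->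
  z i *m M i x = M i x *m xi i.

(* [normalize x] is the point of the orbit of [x] whose frame is standard. *)
Definition normalize x := handsaw_act (fun i => invmx (M i x)) x.
Definition framed : set (handsaw K N NW) := [set x | forall i, M i x \in unitmx].

Lemma framed_act x g : (forall i, g i \in unitmx) ->
  framed x -> framed (handsaw_act g x).
Proof. by move=> ug ux i; rewrite M_act // unitmx_mul ug ux. Qed.

Lemma normalize_act x g : (forall i, g i \in unitmx) -> framed x ->
  normalize (handsaw_act g x) = normalize x.
Proof.
move=> ug ux; rewrite /normalize handsaw_actM // => [|i]; last first.
  by rewrite unitmx_inv framed_act.
congr handsaw_act; apply: functional_extensionality_dep => i.
by rewrite M_act // invmxM // mulmxKV.
Qed.

Lemma normalize_weight x z : framed x -> weight_operator s x z ->
  weight_operator s (normalize x) xi.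
Proof.
move=> ux wx; have uV i : invmx (M i x) \in unitmx by rewrite unitmx_inv.
have := weight_operator_act uV wx.
rewrite (_ : (fun i => _ *m z i *m _) = xi) //.
apply: functional_extensionality_dep => i.
by rewrite invmxK -mulmxA (M_weight _ wx) mulKmx.
Qed.

(** The conditions for [i] outside [r] concern matrices of size 0, so a finite product of
    determinants cuts out the complement. *)
Lemma zopen_framed : zopen AX framed.
Proof.
pose p x := \prod_(i <- r) \det (M i x).
have -> : framed = [set x | setT x /\ p x != 0].
  apply/seteqP; split=> [x ux|x [_ px] i].
    split=> //; rewrite /p prodf_seq_neq0; apply/allP => i _ /=.
    by have := ux i; rewrite unitmxE unitfE.
  have [ir|/N_supp Ni0] := boolP (i \in r).
    move: px; rewrite /p prodf_seq_neq0 => /allP/(_ i ir) /=.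
    by rewrite unitmxE unitfE.
  suff /mulmx1_unit[] : M i x *m M i x = 1%:M by [].
  exact: mx_row0.
apply: zopen_regular; first exact/zopenT/affine_ringed.
apply: (@regular_prod _ _ _ _ _ _ _ (fun i x => \det (M i x))) => i.
by apply: regular_det.
Qed.

Lemma morphism_on_normalize :
  morphism_on (X := AX) (Y := AY) framed (extract GV GW \o normalize).
Proof.
have sub U m n (A : handsaw K N NW -> 'M[K]_(m, n)) :
    regular_mx (@handsaw_coord K N NW) setT A -> zopen AX U ->
    regular_mx (@handsaw_coord K N NW) U A.
  by move=> rA oU; apply: regular_mx_restrict rA.
have rM i : regular_mx (@handsaw_coord K N NW) framed (M i).
  by apply: sub; [apply: M_regular|apply: zopen_framed].
have rV i : regular_mx (@handsaw_coord K N NW) framed (fun x => invmx (M i x)).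
  by apply: regular_invmx.
have rB1 i : regular_mx (@handsaw_coord K N NW) framed (fun x => hB1 (normalize x) i).
  rewrite /normalize /=; under eq_fun do rewrite invmxK.
  apply: regular_mxM => //; apply: regular_mxM => //.
  by apply: sub; [apply: regular_hB1|apply: zopen_framed].
have rB2 i : regular_mx (@handsaw_coord K N NW) framed (fun x => hB2 (normalize x) i).
  rewrite /normalize /=; under eq_fun do rewrite invmxK.
  apply: regular_mxM => //; apply: regular_mxM => //.
  by apply: sub; [apply: regular_hB2|apply: zopen_framed].
have ra i : regular_mx (@handsaw_coord K N NW) framed (fun x => ha (normalize x) i).
  by apply: regular_mxM => //; apply: sub; [apply: regular_ha|apply: zopen_framed].
have rb i : regular_mx (@handsaw_coord K N NW) framed (fun x => hb (normalize x) i).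
  rewrite /normalize /=; under eq_fun do rewrite invmxK.
  by apply: regular_mxM => //; apply: sub; [apply: regular_hb|apply: zopen_framed].
have sandwich a b d e (A : 'M[K]_(a, b)) (B : 'M[K]_(d, e)) f :
    regular_mx (@handsaw_coord K N NW) framed f ->
    regular_mx (@handsaw_coord K N NW) framed (fun y => A *m f y *m B).
  move=> rf; apply: regular_mxM; last exact: regular_mx_cst.
  by apply: regular_mxM; first exact: regular_mx_cst.
apply: morphism_on_affine; first exact: zopen_framed.
move=> c [] [j [k [p [q ->]]]].
- exact: (sandwich _ _ _ _ _ _ _ (rB1 _)).
- exact: (sandwich _ _ _ _ _ _ _ (rB2 _)).
- exact: (sandwich _ _ _ _ _ _ _ (ra _)).
- exact: (sandwich _ _ _ _ _ _ _ (rb _)).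
Qed.

(** On framed classes [f] is induced by [psi], which lives on the whole handsaw variety. As
    [normalize] is constant on framed orbits, [psi] does not depend on the representatives chosen
    there. *)
Lemma morphism_on_matched (f : Z -> QY) : (forall z, matched z (f z)) ->
  exists U : set Z, (forall x : X, framed (sval x) -> forall z, sval z = clX x -> U z) /\
    morphism_on U f.
Proof.
move=> fP.
have /choice[rep repE] : forall c : Q, exists x : X, c = clX x := @orbit_classP _ _ _.
pose psi (c : Q) : AY := extract GV GW (normalize (sval (rep c))).
pose U : set Q := [set c | framed (sval (rep c))].
have repP x : exists2 g, (forall i, g i \in unitmx) &
  sval (rep (clX x)) = handsaw_act g (sval x).
  by apply/clX_eq; rewrite -repE.
have UE x : U (clX x) <-> framed (sval x).
  have [g ug gE] := repP x; rewrite /U /= gE; split=> [|]; last exact: framed_act.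
  have ugV i : invmx (g i) \in unitmx by rewrite unitmx_inv.
  by move/(framed_act ugV); rewrite handsaw_actK.
have psiE (x : X) : framed (sval x) -> psi (clX x) = extract GV GW (normalize (sval x)).
  by move=> ux; have [g ug gE] := repP x; rewrite /psi gE normalize_act.
exists (sval @^-1` U); split=> [x ux z zx|]; first by rewrite /= zx; apply/UE.
(* The frame does not need [x] to be fixed by [s], so [psi] is defined on an
   open subset of the whole handsaw variety. *)
have psiU : morphism_on U psi.
  apply: morphism_on_quot.
  have -> : orbit_class handsaw_equiv @^-1` U = (sval : X -> AX) @^-1` framed.
    by apply/seteqP; split=> x /UE.
  refine (@morphism_on_eq _ X AY _ ((extract GV GW \o normalize) \o sval) _ ringedX _ _).
    by move=> x ux /=; rewrite psiE.
  exact: (morphism_on_compr (@morphism_sval _ _ _) morphism_on_normalize).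
have psiZ : morphism_on (X := Z) (sval @^-1` U) (psi \o sval).
  exact: (morphism_on_compr (@morphism_sval _ _ _) psiU).
(* Away from fixed classes the extracted blocks need not satisfy the moment equation or stability,
   so [psi] maps only to the ambient affine space. At points of [Z] they do, and [F] lifts [f] to
   [Y]; off [U] any representative of [f z] serves. *)
have /choice[F FP] : forall z, exists y : Y,
    clY y = f z /\ ((sval @^-1` U) z -> psi (sval z) = sval y).
  move=> z; have [Uz|nUz] := pselect ((sval @^-1` U) z); last first.
    by have [y ->] := orbit_classP (f z); exists y; split.
  have [x zx wx] := graded_rep z.
  have ux : framed (sval x) by apply/UE; rewrite -zx.
  have uV i : invmx (M i (sval x)) \in unitmx by rewrite unitmx_inv.
  have [x' x'E x'x] := handsaw_space_act x uV.
  have wx' : weight_operator s (sval x') xi by rewrite x'E; apply: normalize_weight wx.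
  have [y xy] := intertwines_quiverA wx'.
  exists y; split=> [|_]; last by rewrite zx psiE // -(extract_intertwines xy) x'E.
  by apply: matched_fun (fP z); exists x', y; rewrite x'x.
apply: (morphism_on_eq ringedZ (f := clY \o F)) => [z _|]; first by have [] := FP z.
apply: morphism_on_compl; last exact: morphism_orbit_class.
by apply: (morphism_on_sub ringedZ _ psiZ) => z /(FP z).2.
Qed.

End Normalization.

Lemma morphism_matched (f : Z -> QY) : (forall z, matched z (f z)) -> morphism f.
Proof.
move=> fP; apply: (morphism_local ringedZ) => z.
have [x zx wx] := graded_rep z; have [_ st] := svalP x.
have [M [M1 M2 M3 M4]] := covariant_frame GV GW intr_inj st wx.
have [U [Uz fU]] := morphism_on_matched M1 M2 M3 fP.
by exists U; split=> //; apply: Uz zx => i; rewrite M4 unitmx1.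
Qed.

Lemma graded_isomorphic : isomorphic Z QY.
Proof.
have /choice[f fP] := matched_total; have /choice[g gP] := matched_surj.
exists f, g; split.
- by move=> z; apply: matched_inj (gP _) (fP z).
- by move=> c; apply: matched_fun (fP _) (gP c).
- exact: morphism_matched.
- exact: morphism_matched_inv.
Qed.

End Isomorphism.

Lemma total_dim_supp (v : int -> int -> nat) :
  finite_set [set p : int * int | v p.1 p.2 != 0%N] ->
  exists r : seq int, forall i, i \notin r -> total_dim v i = 0%N.
Proof.
move=> fv; have [r' [_ _ vE]] := total_dim_seq fv.
have /finite_seqP[S vS] := fv; exists [seq p.1 | p <- S] => i iS.
rewrite vE big1_seq // => m _; apply/eqP/negP => vim; move/negP: iS; apply.
have : [set p : int * int | v p.1 p.2 != 0%N] (i, m) by apply/negP.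
by rewrite vS => /= imS; apply/mapP; exists (i, m).
Qed.

Lemma quiverA_dimV_even v (i j k : int) :
  j - k + 0 = i + i -> quiverA_dimV v j k = v i (j - i).
Proof.
move=> jk; rewrite /quiverA_dimV (_ : j - k = i * 2); last by lia.
by rewrite dvdz_mull // mulzK // (_ : j + k = (j - i) * 2) ?mulzK //; lia.
Qed.

Lemma quiverA_dimV_odd v (j k : int) :
  (forall i, j - k + 0 != i + i) -> quiverA_dimV v j k = 0%N.
Proof.
move=> jk; rewrite /quiverA_dimV; case: ifP => // /dvdzP[i E].
by have /eqP[] := jk i; lia.
Qed.

Lemma quiverA_dimW_even w (i j k : int) :
  j - k + 1 = i + i -> quiverA_dimW w j k = w i (j - i).
Proof.
move=> jk; rewrite /quiverA_dimW (_ : j - k + 1 = i * 2); last by lia.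
by rewrite dvdz_mull // mulzK // (_ : j + k - 1 = (j - i) * 2) ?mulzK //; lia.
Qed.

Lemma quiverA_dimW_odd w (j k : int) :
  (forall i, j - k + 1 != i + i) -> quiverA_dimW w j k = 0%N.
Proof.
move=> jk; rewrite /quiverA_dimW; case: ifP => // /dvdzP[i E].
by have /eqP[] := jk i; lia.
Qed.

(* [s] is the grading W_i = (+)_m W_i(m) of W_i = C^(total_dim w i), given by the
   operator acting on W_i(m) by m. *)
Theorem theorem7p3 (R : realType) (n : nat) (v w : int -> int -> nat)
    (hv : graded_dimvec 1 (n%:Z - 1) v) (hw : graded_dimvec 1 n%:Z w)
    (s : forall i : int, 'M[R[i]]_(total_dim w i))
    (hs : semisimple_with_dims s w) :
  isomorphic (graded_handsaw_variety v s)
             (quiverA_variety R[i] (quiverA_dimV v) (quiverA_dimW w)).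
Proof.
have inj : injective (fun m : int => m%:~R : R[i]) by exact: intr_inj.
have [fv _] := hv; have [fw _] := hw.
have gradV (z : forall i, 'M[R[i]]_(total_dim v i)) :
    semisimple_with_dims z v -> inhabited (grading z (quiverA_dimV v) 0).
  move=> hz; apply: (semisimple_grading inj fv hz).
    exact: quiverA_dimV_even.
  exact: quiverA_dimV_odd.
have [xi hxi] := exists_semisimple inj fv; have [GV] := gradV xi hxi.
have [GW] : inhabited (grading s (quiverA_dimW w) 1).
  apply: (semisimple_grading inj fw hs).
    exact: quiverA_dimW_even.
  exact: quiverA_dimW_odd.
have [r rP] := total_dim_supp fv.
exact: (graded_isomorphic GV GW inj hxi gradV rP).
Qed.
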